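(* Let $K$ be a field and $\Gamma$ a Brauer configuration. Then the Brauer configuration algebra $\Lambda_\Gamma$ is a multiserial algebra.
   Context: Multiserial algebra. A finite dimensional algebra $A$ is multiserial if, for every indecomposable projective left and right $A$-module $P$, $\mathrm{rad}(P)=\sum_{i=1}^nU_i$ for some $n$ and uniserial submodules $U_i$ of $\mathrm{rad}(P)$ such that, for $i\neq j$, $U_i\cap U_j$ is either $0$ or a simple $A$-module. Brauer configuration. A Brauer configuration $\Gamma=(\Gamma_0,\Gamma_1,\mu,\mathfrak o)$ consists of a finite set $\Gamma_0$ of vertices, a finite collection $\Gamma_1$ of labelled finite multisets of elements of $\Gamma_0$, called polygons (differently labelled polygons may be equal as multisets; a $d$-gon is a polygon with $d$ elements counted with multiplicity), a multiplicity function $\mu\colon\Gamma_0\to\mathbb Z_{>0}$, and an orientation $\mathfrak o$. For $\alpha\in\Gamma_0$, $V\in\Gamma_1$, $\mathrm{occ}(\alpha,V)$ is the number of times $\alpha$ occurs in $V$, and $\mathrm{val}(\alpha)=\sum_{V\in\Gamma_1}\mathrm{occ}(\alpha,V)$. An orientation is a choice, for each $\alpha\in\Gamma_0$, of a cyclic ordering of the list of polygons containing $\alpha$, where each $V$ is listed $\mathrm{occ}(\alpha,V)$ times (the different occurrences being distinguished). It is required that: every vertex lies in at least one polygon; every polygon has at least two vertices (counted with multiplicity); every polygon contains a vertex $\alpha$ with $\mathrm{val}(\alpha)\mu(\alpha)>1$. A vertex $\alpha$ is truncated if $\mathrm{val}(\alpha)\mu(\alpha)=1$, and nontruncated otherwise.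 Quiver. $\mathcal Q_\Gamma$ has one vertex $v$ for each polygon $V\in\Gamma_1$. For a nontruncated $\alpha$, the cyclically ordered list $V_1<\dots<V_t$ ($t=\mathrm{val}(\alpha)$, $V_{t+1}=V_1$) given by $\mathfrak o$ is the successor sequence at $\alpha$; for each $r=1,\dots,t$ there is an arrow $a_r$ from the vertex $v_r$ associated to $V_r$ to the vertex $v_{r+1}$ associated to $V_{r+1}$ (a loop if $t=1$). The arrows obtained for different $\alpha$ and different $r$ are distinct, and these are all arrows of $\mathcal Q_\Gamma$. Paths are written from left to right. Special cycles. With this notation put $C_j=a_ja_{j+1}\cdots a_ta_1\cdots a_{j-1}$. If $V$ is a polygon containing $\alpha$, the special $\alpha$-cycles at $v$ are the $C_j$ with $V_j=V$ (so there are $\mathrm{occ}(\alpha,V)$ of them). Algebra. $\Lambda_\Gamma=K\mathcal Q_\Gamma/I_\Gamma$, where $I_\Gamma$ is generated by: (type one) all $C^{\mu(\alpha)}-(C')^{\mu(\beta)}$ where, for some polygon $V$, $C$ is a special $\alpha$-cycle at $v$ and $C'$ is a special $\beta$-cycle at $v$, with $\alpha,\beta$ nontruncated vertices of $V$ (possibly $\alpha=\beta$); (type two) all $C^{\mu(\alpha)}a$ where $C$ is a special $\alpha$-cycle and $a$ is the first arrow of $C$; (type three) all paths $ab$ of length two that are not a subpath of any special cycle, except those with $a=b$ a loop associated to a vertex $\alpha$ with $\mathrm{val}(\alpha)=1$ and $\mu(\alpha)>1$. *)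

(* Defs.v *)
Set Warnings "-notation-overridden,-notation-incompatible-prefix,-ambiguous-paths,-projection-no-head-constant,-redundant-canonical-projection".
From HB Require Import structures.
From mathcomp Require Import all_boot perm all_algebra.
From mathcomp Require Import finmap multiset boolp classical_sets monalg.

Set Implicit Arguments.
Unset Strict Implicit.
Unset Printing Implicit Defensive.

Import GRing.Theory.

Local Open Scope classical_set_scope.
Local Open Scope ring_scope.
Local Open Scope quotient_scope.

(* The library's algType K requires 1 != 0, but a Brauer configuration without
   polygons has the zero algebra. *)
Record algebra (K : fieldType) := Algebra {
  alg_ring :> pzRingType;
  alg_map : {rmorphism K -> alg_ring};
  alg_mapC : forall (c : K) (x : alg_ring), alg_map c * x = x * alg_map c
}.

Section AlgebraVectorSpace.
Variables (K : fieldType) (A : algebra K).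

Definition alg_space : Type := A.
HB.instance Definition _ := GRing.Zmodule.on alg_space.

Definition alg_scale (c : K) (x : alg_space) : alg_space :=
  alg_map A c * (x : A).

Lemma alg_scaleA c d x : alg_scale c (alg_scale d x) = alg_scale (c * d) x.
Proof. by rewrite /alg_scale mulrA -rmorphM. Qed.

Lemma alg_scale1 : left_id 1 alg_scale.
Proof. by move=> x; rewrite /alg_scale rmorph1 mul1r. Qed.

Lemma alg_scaleDr : right_distributive alg_scale +%R.
Proof. by move=> c x y; rewrite /alg_scale mulrDr. Qed.

Lemma alg_scaleDl x : {morph alg_scale^~ x : c d / c + d}.
Proof. by move=> c d; rewrite /alg_scale rmorphD mulrDl. Qed.

HB.instance Definition _ := GRing.Zmodule_isLmodule.Build K alg_space
  alg_scaleA alg_scale1 alg_scaleDr alg_scaleDl.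

End AlgebraVectorSpace.

Section Modules.
Variable A : pzRingType.

Definition submodule (M : lmodType A) (U : set M) : Prop :=
  GRing.submod_closed (mem U).

Definition submodule_sum (M : lmodType A) (n : nat) (U : 'I_n -> set M) :
    set M :=
  [set x | exists u : 'I_n -> M, (forall i, U i (u i)) /\ x = \sum_i u i].

Definition maximal_submodule (M : lmodType A) (N : set M) : Prop :=
  [/\ submodule N, N <> [set: M] &
      forall N' : set M, submodule N' -> N `<=` N' -> N' = N \/ N' = [set: M]].

Definition module_rad (M : lmodType A) : set M :=
  \bigcap_(N in @maximal_submodule M) N.

(* The zero submodule is uniserial with this definition. *)
Definition uniserial (M : lmodType A) (U : set M) : Prop :=
  submodule U /\
  forall V W : set M, submodule V -> submodule W -> V `<=` U -> W `<=` U ->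
    V `<=` W \/ W `<=` V.

Definition simple_submodule (M : lmodType A) (U : set M) : Prop :=
  [/\ submodule U, U <> [set 0] &
      forall V : set M, submodule V -> V `<=` U -> V = [set 0] \/ V = U].

Definition projective (P : lmodType A) : Prop :=
  forall (M N : lmodType A) (f : {linear M -> N}) (g : {linear P -> N}),
    (forall y, exists x, f x = y) ->
    exists h : {linear P -> M}, forall x, f (h x) = g x.

Definition indecomposable (P : lmodType A) : Prop :=
  [set: P] <> [set 0] /\
  forall U V : set P, submodule U -> submodule V ->
    U `&` V = [set 0] -> (forall x, exists u v, [/\ U u, V v & x = u + v]) ->
    U = [set 0] \/ V = [set 0].

Definition multiserial_rad (P : lmodType A) : Prop :=
  exists (n : nat) (U : 'I_n -> set P),
    [/\ forall i, uniserial (U i) /\ U i `<=` @module_rad P,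
        @module_rad P = submodule_sum U &
        forall i j, i != j ->
          U i `&` U j = [set 0] \/ simple_submodule (U i `&` U j)].

End Modules.

Definition finite_dimensional (K : fieldType) (V : lmodType K) : Prop :=
  exists n : nat, inhabited (Vector.axiom n V).

(* Right A-modules are the left modules over the opposite ring A^c. *)
Definition multiserial (K : fieldType) (A : algebra K) : Prop :=
  [/\ finite_dimensional (alg_space A),
      forall P : lmodType A,
        projective P -> indecomposable P -> multiserial_rad P &
      forall P : lmodType A^c,
        projective P -> indecomposable P -> multiserial_rad P].

Record quiver := Quiver {
  qvertex : finType;
  qarrow : finType;
  qsrc : qarrow -> qvertex;
  qtgt : qarrow -> qvertex
}.

Section Paths.
Variable Q : quiver.

Fixpoint is_walk (v : qvertex Q) (s : seq (qarrow Q)) : bool :=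
  if s is a :: s' then (qsrc a == v) && is_walk (qtgt a) s' else true.

(* The starting vertex is recorded to account for the trivial paths. *)
Definition is_path (p : qvertex Q * seq (qarrow Q)) : bool := is_walk p.1 p.2.
Record qpath := QPath {
  pdata : qvertex Q * seq (qarrow Q);
  _ : is_path pdata
}.
HB.instance Definition _ := [isSub for pdata].
HB.instance Definition _ := [Choice of qpath by <:].

Definition pstart (p : qpath) : qvertex Q := (val p).1.
Definition parrows (p : qpath) : seq (qarrow Q) := (val p).2.
Definition pend (p : qpath) : qvertex Q :=
  last (pstart p) [seq qtgt a | a <- parrows p].

Definition trivial_path (v : qvertex Q) : qpath :=
  @QPath (v, [::]) isT.

Lemma arrow_path_subproof (a : qarrow Q) : is_walk (qsrc a) [:: a].
Proof. by rewrite /= eqxx. Qed.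

Definition arrow_path (a : qarrow Q) : qpath :=
  @QPath (qsrc a, [:: a]) (arrow_path_subproof a).

(* Paths are composed from left to right: p comes first. *)
Definition pcomp (p q : qpath) : option qpath :=
  if pend p == pstart q then insub (pstart p, parrows p ++ parrows q)
  else None.

Lemma is_walk_cat v s t :
  is_walk v (s ++ t) = is_walk v s && is_walk (last v (map (@qtgt Q) s)) t.
Proof. by elim: s v => [|a s IH] v //=; rewrite IH andbA. Qed.

Lemma pcompP (p q : qpath) : pend p = pstart q ->
  exists2 r, pcomp p q = Some r &
    [/\ pstart r = pstart p, parrows r = parrows p ++ parrows q
      & pend r = pend q].
Proof.
move=> e; have w : is_path (pstart p, parrows p ++ parrows q).
  rewrite /is_path /= is_walk_cat -/(pend p) e; apply/andP; split.
    exact: (valP p).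
  exact: (valP q).
rewrite /pcomp e eqxx.
exists (QPath w).
  by rewrite (insubT is_path w).
by split; rewrite //= /pend /= /parrows/= map_cat last_cat -/(pend p) e.
Qed.

Lemma qpath_eq (p q : qpath) :
  pstart p = pstart q -> parrows p = parrows q -> p = q.
Proof.
rewrite /pstart /parrows => e1 e2; apply/val_inj.
by case: (val p) (val q) e1 e2 => [? ?] [? ?] /= -> ->.
Qed.

Lemma pcompA (p q r : qpath) :
  obind (pcomp p) (pcomp q r) = obind (pcomp^~ r) (pcomp p q).
Proof.
have N x y : pend x <> pstart y -> pcomp x y = None.
  by move=> /eqP/negPf e; rewrite /pcomp e.
have [/eqP e|/eqP e] := boolP (pend q == pstart r); last first.
  rewrite (N _ _ e) /=; case E : (pcomp p q) => [z|] //=.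
  have [/eqP f|/eqP f] := boolP (pend p == pstart q); last by rewrite N in E.
  have [z' Ez' [_ _ zE]] := pcompP f.
  by move: E; rewrite Ez' => -[<-]; rewrite N // zE.
have [y -> [ys ya ye]] := pcompP e; rewrite /=.
have [/eqP f|/eqP f] := boolP (pend p == pstart q); last first.
  by rewrite (N _ _ f) /= N // ys.
have [z -> [zs za ze]] := pcompP f; rewrite /=.
have [x -> [xs xa _]] := pcompP (etrans f (esym ys)).
have [t -> [ts ta _]] := pcompP (etrans ze e).
congr (Some _); apply: qpath_eq; first by rewrite xs ts zs.
by rewrite ta xa za ya catA.
Qed.

Lemma insub_path p :
  insub (pstart p, parrows p) = Some p :> option qpath.
Proof.
rewrite -[RHS](valK p) /pstart /parrows.
by rewrite -surjective_pairing.
Qed.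

Lemma pcomp_trivl v p :
  pcomp (trivial_path v) p = if v == pstart p then Some p else None.
Proof.
by rewrite /pcomp /pend /=; case: eqP => // e; rewrite -[RHS]insub_path -e.
Qed.

Lemma pcomp_trivr v p :
  pcomp p (trivial_path v) = if v == pend p then Some p else None.
Proof. by rewrite /pcomp eq_sym cats0 insub_path. Qed.

End Paths.

Definition path_algebra (K : fieldType) (Q : quiver) : Type := {malg K[qpath Q]}.

HB.instance Definition _ (K : fieldType) (Q : quiver) :=
  GRing.Zmodule.on (path_algebra K Q).

(* The locks below keep failing conversion tests from computing with finitely
   supported functions. *)
HB.lock Definition pa_scale (K : fieldType) (Q : quiver) (c : K)
    (g : path_algebra K Q) : path_algebra K Q := c *: (g : {malg K[qpath Q]}).
Canonical pa_scale_unlockable := Unlockable pa_scale.unlock.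

Section PathAlgebraScale.
Variables (K : fieldType) (Q : quiver).
Local Notation scale := (@pa_scale K Q).

Lemma pa_scaleA c d g : scale c (scale d g) = scale (c * d) g.
Proof. by rewrite unlock scalerA. Qed.

Lemma pa_scale1 : left_id 1 scale.
Proof. by move=> g; rewrite unlock scale1r. Qed.

Lemma pa_scaleDr : right_distributive scale +%R.
Proof. by move=> c g h; rewrite unlock scalerDr. Qed.

Lemma pa_scaleDl g : {morph scale^~ g : c d / c + d}.
Proof. by move=> c d; rewrite unlock scalerDl. Qed.

HB.instance Definition _ := GRing.Zmodule_isLmodule.Build K (path_algebra K Q)
  pa_scaleA pa_scale1 pa_scaleDr pa_scaleDl.

Lemma pa_coeffZ c (g : path_algebra K Q) (p : qpath Q) :
  (c *: g)@_p = c * g@_p.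
Proof. by rewrite /GRing.scale /= unlock mcoeffZ. Qed.

End PathAlgebraScale.

HB.lock Definition path_elt (K : fieldType) (Q : quiver) (p : qpath Q) :
  path_algebra K Q := << p >>.
Arguments path_elt K {Q} p.
Canonical path_elt_unlockable := Unlockable path_elt.unlock.

Definition opath_elt (K : fieldType) (Q : quiver) (o : option (qpath Q)) :
  path_algebra K Q :=
  oapp (path_elt K) 0 o.

HB.lock Definition pa_mul (K : fieldType) (Q : quiver)
    (g h : path_algebra K Q) : path_algebra K Q :=
  \sum_(p <- msupp g) \sum_(q <- msupp h)
     (g@_p * h@_q) *: opath_elt K (pcomp p q).
Arguments pa_mul {K Q} g h.
Canonical pa_mul_unlockable := Unlockable pa_mul.unlock.

Section PathAlgebra.
Variables (K : fieldType) (Q : quiver).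
Local Notation path_algebra := (path_algebra K Q).
Local Notation path_elt := (path_elt K).
Local Notation opath_elt := (opath_elt K).
Implicit Types g h k : path_algebra.

Definition pa_one : path_algebra := \sum_v path_elt (trivial_path v).

Lemma pa_mulEw (d e : {fset qpath Q}) g h :
  (msupp g `<=` d)%fset -> (msupp h `<=` e)%fset ->
  pa_mul g h =
  \sum_(p <- d) \sum_(q <- e) (g@_p * h@_q) *: opath_elt (pcomp p q).
Proof.
move=> gd he; rewrite pa_mul.unlock (big_fset_incl _ gd) /=; last first.
  move=> p _ /mcoeff_outdom gp.
  by rewrite big1 // => q _; rewrite gp mul0r scale0r.
apply: eq_bigr => p _; apply: big_fset_incl => // q _ /mcoeff_outdom ->.
by rewrite mulr0 scale0r.
Qed.

Lemma pa_mulDl : left_distributive (@pa_mul K Q) +%R.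
Proof.
move=> g1 g2 h.
rewrite (pa_mulEw (msuppD_le g1 g2) (fsubset_refl _)).
rewrite (pa_mulEw (fsubsetUl (msupp g1) (msupp g2)) (fsubset_refl (msupp h))).
rewrite (pa_mulEw (fsubsetUr (msupp g1) (msupp g2)) (fsubset_refl (msupp h))).
rewrite -big_split /=; apply: eq_bigr => p _.
rewrite -big_split /=; apply: eq_bigr => q _.
by rewrite mcoeffD mulrDl scalerDl.
Qed.

Lemma pa_mulDr : right_distributive (@pa_mul K Q) +%R.
Proof.
move=> h g1 g2.
rewrite (pa_mulEw (fsubset_refl _) (msuppD_le g1 g2)).
rewrite (pa_mulEw (fsubset_refl (msupp h)) (fsubsetUl (msupp g1) (msupp g2))).
rewrite (pa_mulEw (fsubset_refl (msupp h)) (fsubsetUr (msupp g1) (msupp g2))).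
rewrite -big_split /=; apply: eq_bigr => p _.
rewrite -big_split /=; apply: eq_bigr => q _.
by rewrite mcoeffD mulrDr scalerDl.
Qed.

Lemma pa_mul0l g : pa_mul 0 g = 0.
Proof. by rewrite pa_mul.unlock msupp0 big_seq_fset0. Qed.

Lemma pa_mul0r g : pa_mul g 0 = 0.
Proof. by rewrite pa_mul.unlock big1 // => p _; rewrite msupp0 big_seq_fset0. Qed.

Lemma msuppZ_fset c g : (msupp (c *: g) `<=` msupp g)%fset.
Proof.
apply/fsubsetP => p; rewrite -!mcoeff_neq0 pa_coeffZ.
by apply: contra_neq => ->; rewrite mulr0.
Qed.

Lemma pa_mulZl c g h : pa_mul (c *: g) h = c *: pa_mul g h.
Proof.
rewrite (pa_mulEw (msuppZ_fset c g) (fsubset_refl _)) pa_mul.unlock scaler_sumr.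
apply: eq_bigr => p _; rewrite scaler_sumr; apply: eq_bigr => q _.
by rewrite pa_coeffZ scalerA mulrA.
Qed.

Lemma pa_mulZr c g h : pa_mul g (c *: h) = c *: pa_mul g h.
Proof.
rewrite (pa_mulEw (fsubset_refl _) (msuppZ_fset c h)) pa_mul.unlock scaler_sumr.
apply: eq_bigr => p _; rewrite scaler_sumr; apply: eq_bigr => q _.
by rewrite pa_coeffZ scalerA mulrCA.
Qed.

Lemma pa_muluu (p q : qpath Q) :
  pa_mul (path_elt p) (path_elt q) = opath_elt (pcomp p q).
Proof.
rewrite path_elt.unlock (pa_mulEw msuppU_le msuppU_le) !big_seq_fset1.
by rewrite !mcoeffUU mulr1 scale1r.
Qed.

Lemma pa_mulou (o : option (qpath Q)) q :
  pa_mul (opath_elt o) (path_elt q) = opath_elt (obind (fun p => pcomp p q) o).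
Proof. by case: o => [p|] /=; rewrite ?pa_muluu ?pa_mul0l. Qed.

Lemma pa_muluo p (o : option (qpath Q)) :
  pa_mul (path_elt p) (opath_elt o) = opath_elt (obind (pcomp p) o).
Proof. by case: o => [q|] /=; rewrite ?pa_muluu ?pa_mul0r. Qed.

Lemma pa_ind (P : path_algebra -> Prop) :
  P 0 -> (forall g h, P g -> P h -> P (g + h)) ->
  (forall c g, P g -> P (c *: g)) -> (forall p, P (path_elt p)) ->
  forall g, P g.
Proof.
move=> P0 PD PZ Pe g; rewrite (monalgE g).
apply: (big_ind P) => // p _.
have -> : << g@_p *g p >> = g@_p *: path_elt p; last by exact/PZ.
apply/malgP => q; rewrite pa_coeffZ path_elt.unlock.
apply: etrans (mcoeffU _ _ _) _; symmetry.
apply: etrans (congr1 _ (mcoeffU _ _ _)) _.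
by case: (p == q); rewrite ?mulr1 // mulr0.
Qed.

Lemma pa_mulA : associative (@pa_mul K Q).
Proof.
move=> g h k; elim/pa_ind: g => [|g g' Eg Eg'|c g Eg|p].
- by rewrite !pa_mul0l.
- by rewrite !pa_mulDl Eg Eg'.
- by rewrite !pa_mulZl Eg.
elim/pa_ind: h => [|h h' Eh Eh'|c h Eh|q].
- by rewrite pa_mul0l !pa_mul0r pa_mul0l.
- by rewrite (pa_mulDl h h' k) (pa_mulDr _ h h') (pa_mulDr (path_elt p))
     (pa_mulDl (pa_mul _ h)) Eh Eh'.
- by rewrite (pa_mulZl c h k) (pa_mulZr c _ h)
     (pa_mulZr c (path_elt p) (pa_mul h k)) (pa_mulZl c (pa_mul _ h)) Eh.
elim/pa_ind: k => [|k k' Ek Ek'|c k Ek|r].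
- by rewrite !pa_mul0r.
- by rewrite !(pa_mulDr _ k k') (pa_mulDr (path_elt p)) Ek Ek'.
- by rewrite !(pa_mulZr c _ k) (pa_mulZr c (path_elt p)) Ek.
by rewrite !pa_muluu pa_mulou pa_muluo pcompA.
Qed.

Lemma pa_mul1l : left_id pa_one (@pa_mul K Q).
Proof.
elim/pa_ind => [|g h Eg Eh|c g Eg|p].
- exact: pa_mul0r.
- by rewrite pa_mulDr Eg Eh.
- by rewrite pa_mulZr Eg.
rewrite /pa_one (big_morph (pa_mul^~ _) (fun _ _ => pa_mulDl _ _ _) (pa_mul0l _)).
rewrite (bigD1 (pstart p)) //= pa_muluu pcomp_trivl eqxx /= big1 ?addr0 //.
by move=> v /negPf np; rewrite pa_muluu pcomp_trivl np.
Qed.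

Lemma pa_mul1r : right_id pa_one (@pa_mul K Q).
Proof.
elim/pa_ind => [|g h Eg Eh|c g Eg|p].
- exact: pa_mul0l.
- by rewrite pa_mulDl Eg Eh.
- by rewrite pa_mulZl Eg.
rewrite /pa_one (big_morph (pa_mul _) (fun _ _ => pa_mulDr _ _ _) (pa_mul0r _)).
rewrite (bigD1 (pend p)) //= pa_muluu pcomp_trivr eqxx /= big1 ?addr0 //.
by move=> v /negPf np; rewrite pa_muluu pcomp_trivr np.
Qed.

HB.instance Definition _ := GRing.Zmodule_isPzRing.Build path_algebra
  pa_mulA pa_mul1l pa_mul1r pa_mulDl pa_mulDr.

Definition pa_scalar (c : K) : path_algebra := c *: pa_one.

Lemma pa_scalar_is_zmod_morphism : zmod_morphism pa_scalar.
Proof. by move=> c d; rewrite /pa_scalar scalerBl. Qed.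

Lemma pa_scalar_is_monoid_morphism : monoid_morphism pa_scalar.
Proof.
split=> [|c d]; first exact: scale1r.
by rewrite /pa_scalar [RHS]pa_mulZl [pa_mul pa_one _]pa_mul1l scalerA.
Qed.

HB.instance Definition _ := GRing.isZmodMorphism.Build K path_algebra pa_scalar
  pa_scalar_is_zmod_morphism.
HB.instance Definition _ := GRing.isMonoidMorphism.Build K path_algebra
  pa_scalar pa_scalar_is_monoid_morphism.

Lemma pa_scalarC c g : pa_scalar c * g = g * pa_scalar c.
Proof.
rewrite /pa_scalar [LHS]pa_mulZl [RHS]pa_mulZr.
by rewrite [pa_mul _ _]pa_mul1l [pa_mul _ _]pa_mul1r.
Qed.

Definition arrow_elt (a : qarrow Q) : path_algebra := path_elt (arrow_path a).

End PathAlgebra.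

Section QuotientRing.
Variable R : pzRingType.

Definition two_sided_ideal (J : set R) : Prop :=
  [/\ J 0, forall x y, J x -> J y -> J (x - y),
      forall a x, J x -> J (a * x) & forall a x, J x -> J (x * a)].

Definition ideal_gen (S : set R) : set R := smallest two_sided_ideal S.

Lemma ideal_gen_ideal (S : set R) : two_sided_ideal (ideal_gen S).
Proof.
split=> [J [[]] //|x y Sx Sy J JP|a x Sx J JP|a x Sx J JP].
- by case: (JP) => -[_ J1 _ _] _; apply: J1; [exact: Sx|exact: Sy].
- by case: (JP) => -[_ _ J1 _] _; apply: J1; exact: Sx.
- by case: (JP) => -[_ _ _ J1] _; apply: J1; exact: Sx.
Qed.

Variable S : set R.

Definition in_ideal_gen : {pred R} := mem (ideal_gen S).

Lemma in_ideal_genP x : reflect (ideal_gen S x) (x \in in_ideal_gen).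
Proof. by apply: (iffP idP) => [/set_mem|/mem_set]. Qed.

Lemma in_ideal_gen_zmod : zmod_closed in_ideal_gen.
Proof.
have [I0 IB _ _] := ideal_gen_ideal S.
split=> [|x y /in_ideal_genP Ix /in_ideal_genP Iy]; apply/in_ideal_genP => //.
exact: IB.
Qed.
HB.instance Definition _ := GRing.isZmodClosed.Build R in_ideal_gen
  in_ideal_gen_zmod.

Definition ring_quot : Type := Quotient.quot in_ideal_gen.
HB.instance Definition _ := GRing.Zmodule.on ring_quot.

Definition quot_pi (x : R) : ring_quot := \pi_(Quotient.quot in_ideal_gen) x.

Definition quot_mul (x y : ring_quot) : ring_quot :=
  quot_pi (repr (x : Quotient.quot in_ideal_gen) *
           repr (y : Quotient.quot in_ideal_gen)).

Lemma quot_piP x y : quot_pi x = quot_pi y <-> ideal_gen S (x - y).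
Proof.
rewrite /quot_pi; split => [/eqP|I].
  by rewrite -Quotient.idealrBE => /in_ideal_genP.
by apply/eqP; rewrite -Quotient.idealrBE; apply/in_ideal_genP.
Qed.

Lemma quot_pi_surj (y : ring_quot) : exists x, y = quot_pi x.
Proof.
by exists (repr (y : Quotient.quot in_ideal_gen)); rewrite /quot_pi reprK.
Qed.

Lemma quot_piM x y : quot_mul (quot_pi x) (quot_pi y) = quot_pi (x * y).
Proof.
have [I0 IB Il Ir] := ideal_gen_ideal S.
rewrite /quot_mul; set x' := repr _; set y' := repr _; apply/quot_piP.
have Ix : ideal_gen S (x' - x) by apply/quot_piP; rewrite /quot_pi reprK.
have Iy : ideal_gen S (y - y') by apply/quot_piP; rewrite /quot_pi reprK.
suff -> : x' * y' - x * y = (x' - x) * y' - x * (y - y').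
  by apply: IB; [exact: Ir|exact: Il].
by rewrite mulrBl mulrBr opprB addrA subrK.
Qed.

Lemma quot_pi_is_zmod_morphism : zmod_morphism quot_pi.
Proof. by move=> x y; rewrite /quot_pi raddfB. Qed.
HB.instance Definition _ := GRing.isZmodMorphism.Build R ring_quot quot_pi
  quot_pi_is_zmod_morphism.

Lemma quot_mulA : associative quot_mul.
Proof.
move=> x y z; have [[x' ->] [y' ->] [z' ->]] :=
  And3 (quot_pi_surj x) (quot_pi_surj y) (quot_pi_surj z).
by rewrite !quot_piM mulrA.
Qed.

Lemma quot_mul1l : left_id (quot_pi 1) quot_mul.
Proof. by move=> x; have [y ->] := quot_pi_surj x; rewrite quot_piM mul1r. Qed.

Lemma quot_mul1r : right_id (quot_pi 1) quot_mul.
Proof. by move=> x; have [y ->] := quot_pi_surj x; rewrite quot_piM mulr1. Qed.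

Lemma quot_mulDl : left_distributive quot_mul +%R.
Proof.
move=> x y z; have [[x' ->] [y' ->] [z' ->]] :=
  And3 (quot_pi_surj x) (quot_pi_surj y) (quot_pi_surj z).
by rewrite -raddfD !quot_piM mulrDl raddfD.
Qed.

Lemma quot_mulDr : right_distributive quot_mul +%R.
Proof.
move=> x y z; have [[x' ->] [y' ->] [z' ->]] :=
  And3 (quot_pi_surj x) (quot_pi_surj y) (quot_pi_surj z).
by rewrite -raddfD !quot_piM mulrDr raddfD.
Qed.

HB.instance Definition _ := GRing.Zmodule_isPzRing.Build ring_quot
  quot_mulA quot_mul1l quot_mul1r quot_mulDl quot_mulDr.

Lemma quot_pi_is_monoid_morphism : monoid_morphism quot_pi.
Proof. by split=> // x y; rewrite -quot_piM. Qed.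
HB.instance Definition _ := GRing.isMonoidMorphism.Build R ring_quot quot_pi
  quot_pi_is_monoid_morphism.

End QuotientRing.

Section QuotientPathAlgebra.
Variables (K : fieldType) (Q : quiver) (S : set (path_algebra K Q)).

Lemma quot_path_algebra_mapC c (x : ring_quot S) :
  (quot_pi S \o @pa_scalar K Q) c * x = x * (quot_pi S \o @pa_scalar K Q) c.
Proof.
by have [y ->] := quot_pi_surj x; rewrite /= -!rmorphM pa_scalarC.
Qed.

Definition quot_path_algebra : algebra K := Algebra quot_path_algebra_mapC.

End QuotientPathAlgebra.

Section Configuration.
Variables (T L : finType) (P : L -> {mset T}%mset).

(* An occurrence of x is a label V with an index below the multiplicity
   of x in the multiset P V. *)
Definition occurrence (x : T) : finType := {V : L & 'I_(P V x)}.

Definition valency (x : T) : nat := (\sum_(V : L) P V x)%N.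

End Configuration.

(* The orientation at x is given by the successor map of the cyclic ordering,
   which is a permutation of the occurrences with a single cycle. *)
Record brauer_configuration := BrauerConfiguration {
  bvertex : finType;
  blabel : finType;
  polygon : blabel -> {mset bvertex}%mset;
  bmult : bvertex -> nat;
  orientation : forall x : bvertex, {perm occurrence polygon x};
  _ : forall x, (0 < bmult x)%N;
  _ : forall x (o o' : occurrence polygon x), o' \in porbit (orientation x) o;
  _ : forall x, exists V, x \in polygon V;
  _ : forall V, (2 <= size (polygon V))%N;
  _ : forall V, exists2 x, x \in polygon V
        & (1 < valency polygon x * bmult x)%N
}.

Section BrauerConfigurationAlgebra.
Variables (K : fieldType) (G : brauer_configuration).

Definition bval (x : bvertex G) : nat := valency (@polygon G) x.

Definition truncated (x : bvertex G) : bool := (bval x * bmult x == 1)%N.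

(* The arrow a_r at x corresponds to the r-th occurrence in the successor
   sequence at x. *)
Definition barrow : finType :=
  {a : {x : bvertex G & occurrence (@polygon G) x} | ~~ truncated (tag a)}.

Definition avertex (a : barrow) : bvertex G := tag (val a).
Definition aocc (a : barrow) : occurrence (@polygon G) (avertex a) :=
  tagged (val a).

Definition barrow_next (a : barrow) : barrow :=
  exist (fun a => ~~ truncated (tag a))
    (Tagged (occurrence (@polygon G)) (orientation (avertex a) (aocc a)))
    (valP a).

Definition brauer_quiver : quiver :=
  @Quiver (blabel G) barrow (fun a => tag (aocc a))
    (fun a => tag (aocc (barrow_next a))).

Definition special_cycle (a : barrow) : seq barrow :=
  traject barrow_next a (bval (avertex a)).

Local Notation KQ := (path_algebra K brauer_quiver).
Local Notation arr := (@arrow_elt K brauer_quiver).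

Definition special_cycle_elt (a : barrow) : KQ :=
  \prod_(b <- special_cycle a) arr b.

Local Notation C := special_cycle_elt.

Definition type_one : set KQ :=
  [set z | exists a b : qarrow brauer_quiver, qsrc a = qsrc b /\
     z = C a ^+ bmult (avertex a) - C b ^+ bmult (avertex b)].

Definition type_two : set KQ :=
  [set z | exists a : qarrow brauer_quiver,
     z = C a ^+ bmult (avertex a) * arr a].

Definition type_three : set KQ :=
  [set z | exists a b : qarrow brauer_quiver,
     [/\ qtgt a = qsrc b,
         forall c, ~~ infix [:: a; b] (special_cycle c),
         ~ [/\ a = b, bval (avertex a) = 1%N & (1 < bmult (avertex a))%N] &
         z = arr a * arr b]].

Definition brauer_algebra : algebra K :=
  quot_path_algebra (type_one `|` type_two `|` type_three).

End BrauerConfigurationAlgebra.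

(* Main.v *)
(* Call a word of arrows good if each letter is followed by its successor and the
   word is shorter than the full cycle C^mu at its vertex. The paths that are not
   good span an ideal containing the relations, so the coefficients at good paths
   are well defined on the quotient A. An indecomposable projective left module
   is A e_v: some coordinate functional of a dual basis has a value outside the
   nilpotent arrow ideal J, which makes it invertible at some e_v and splits off
   A e_v. Its radical is J e_v, the sum of the A a over the arrows a ending at v,
   and A a is uniserial because a can be prolonged to the left in one way only.
   If a <> b, the coefficients at good paths show that A a and A b can only meet
   in the line spanned by C^mu, which J annihilates. The opposite algebra has the
   same shape, with the successor map in place of the predecessor map. *)
From HB Require Import structures.
Require Import Defs.
From mathcomp Require Import all_boot all_algebra.
From mathcomp Require Import finmap boolp classical_sets monalg perm.

Set Implicit Arguments.
Unset Strict Implicit.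
Unset Printing Implicit Defensive.

Import GRing.Theory.

Local Open Scope classical_set_scope.
Local Open Scope ring_scope.

(** * Units from nilpotent elements, and submodules *)

(** The geometric series is a right inverse of [1 - z] and commutes with it. *)
Lemma nilpotent_unit (R : pzRingType) (z : R) n :
  z ^+ n = 0 -> exists u, u * (1 - z) = 1.
Proof.
move=> zn; exists (\sum_(i < n) z ^+ i).
have E : (1 - z) * (\sum_(i < n) z ^+ i) = 1.
  by rewrite -opprB mulNr -subrX1 zn sub0r opprK.
rewrite -[RHS]E; apply: commrD; [exact: commr1|apply/commrN/commr_sym].
by apply: commr_sum => i _; apply: commrX.
Qed.

Lemma submoduleP (A : pzRingType) (M : lmodType A) (U : set M) :
  submodule U <->
  [/\ U 0, forall x y, U x -> U y -> U (x + y) & forall c x, U x -> U (c *: x)].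
Proof.
split=> [[U0 UL]|[U0 UD UZ]].
  have u0 : U 0 by move: U0 => /set_mem.
  have ul c x y : U x -> U y -> U (c *: x + y).
    by move=> Ux Uy; apply/set_mem/UL; apply/mem_set.
  split=> // [x y Ux Uy|c x Ux]; first by rewrite -[x]scale1r; exact: ul.
  by rewrite -[_ *: _]addr0; exact: ul.
split=> [|c x y /set_mem Ux /set_mem Uy]; apply/mem_set => //.
by apply: UD => //; apply: UZ.
Qed.

(** * Free modules and dual bases of projective modules *)

Section FreeModule.
Variables (R : pzRingType) (T : choiceType).

(** The lifting property in [projective] is applied below to the surjection from this module onto
    [P], with the elements of [P] as basis. *)
Definition free_module : Type := {malg R[T]}.
HB.instance Definition _ := GRing.Zmodule.on free_module.

Definition free_scale (c : R) (g : free_module) : free_module :=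
  \sum_(k <- msupp g) << c * g@_k *g k >>.

Lemma free_scaleE c g k : (free_scale c g)@_k = c * g@_k.
Proof.
rewrite /free_scale (raddf_sum (mcoeff k)) /=.
under eq_bigr do rewrite mcoeffU.
have [kg|kg] := boolP (k \in msupp g); last first.
  rewrite mcoeff_outdom // mulr0 big_seq big1 // => i ig.
  by case: eqP kg ig => // -> /negP.
rewrite (big_fsetD1 k kg) /= eqxx big1_seq ?addr0 ?mulr1n // => i /=.
by rewrite in_fsetD1 => /andP[/negPf ->].
Qed.

Lemma free_scaleA c d g : free_scale c (free_scale d g) = free_scale (c * d) g.
Proof. by apply/malgP => k; rewrite !free_scaleE mulrA. Qed.

Lemma free_scale1 : left_id 1 free_scale.
Proof. by move=> g; apply/malgP => k; rewrite free_scaleE mul1r. Qed.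

Lemma free_scaleDr : right_distributive free_scale +%R.
Proof.
by move=> c g h; apply/malgP => k; rewrite mcoeffD !free_scaleE mcoeffD mulrDr.
Qed.

Lemma free_scaleDl g : {morph free_scale^~ g : c d / c + d}.
Proof.
by move=> c d; apply/malgP => k; rewrite mcoeffD !free_scaleE mulrDl.
Qed.

HB.instance Definition _ := GRing.Zmodule_isLmodule.Build R free_module
  free_scaleA free_scale1 free_scaleDr free_scaleDl.

Lemma free_coeffZ c (g : free_module) k : (c *: g)@_k = c * g@_k.
Proof. exact: free_scaleE. Qed.

End FreeModule.

Section FreeCover.
Variables (R : pzRingType) (P : lmodType R).

Definition free_eval (g : free_module R P) : P :=
  \sum_(x <- msupp g) g@_x *: x.

(** A common index set makes the evaluations of functions with different supports comparable. *)
Lemma free_evalw (d : {fset P}) (g : free_module R P) :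
  (msupp g `<=` d)%fset -> free_eval g = \sum_(x <- d) g@_x *: x.
Proof.
move=> gd; apply: big_fset_incl => // x _ /mcoeff_outdom ->.
by rewrite scale0r.
Qed.

Lemma free_eval_linear : linear free_eval.
Proof.
move=> c g h; pose d := (msupp g `|` msupp h `|` msupp (c *: g + h)%R)%fset.
rewrite (@free_evalw d); last exact: fsubsetUr.
rewrite (@free_evalw d g); last first.
  by apply: fsubset_trans (fsubsetUl _ _); exact: fsubsetUl.
rewrite (@free_evalw d h); last first.
  by apply: fsubset_trans (fsubsetUl _ _); exact: fsubsetUr.
rewrite scaler_sumr -big_split /=; apply: eq_bigr => x _.
by rewrite mcoeffD free_coeffZ scalerDl scalerA.
Qed.

HB.instance Definition _ := GRing.isLinear.Build R (free_module R P) P _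
  free_eval free_eval_linear.

Lemma free_eval_surj x : exists g, free_eval g = x.
Proof.
exists << 1 *g x >>; rewrite (@free_evalw [fset x]%fset) ?msuppU_le //.
by rewrite big_seq_fset1 mcoeffUU scale1r.
Qed.

(* The coordinates of a section of the free cover. *)
Lemma projective_dual_basis : projective P ->
  exists f : P -> {linear P -> R^o}, forall p,
    exists d : {fset P}, p = \sum_(x <- d) (f x p : R) *: x.
Proof.
move=> /(_ _ _ free_eval (idfun : {linear P -> P}) free_eval_surj)[h hE].
have lin x : linear (fun p => (h p)@_x : R^o).
  by move=> c p q; rewrite linearP mcoeffD free_coeffZ.
pose f x : {linear P -> R^o} := HB.pack (fun p => (h p)@_x : R^o)
  (GRing.isLinear.Build R P R^o *:%R _ (lin x)).
by exists f => p; exists (msupp (h p)); rewrite -[LHS](hE p).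
Qed.

End FreeCover.

(** * Chain presentations and their arrow ideals *)

(** Chains grow on the left; the one of index [n] has [n.+1] factors. *)
Fixpoint arrow_chain (B : pzRingType) (E : Type) (x : E -> B) (next : E -> E)
    (a : E) (n : nat) : B :=
  if n is m.+1 then x (iter n next a) * arrow_chain x next a m else x a.

(* The shape shared by a Brauer configuration algebra and its opposite: the only
   arrow that may be multiplied to the left of [a] is [cp_next a]; the products
   prolonging [a] in this way end in a socle element that depends only on the
   vertex of [a]; the functionals [cp_coef] separate the shorter products. *)
Record chain_presentation (K : fieldType) (B : pzRingType) := {
  cp_scalar : {rmorphism K -> B};
  cp_vertex : finType;
  cp_arrow : finType;
  cp_idem : cp_vertex -> B;
  cp_elt : cp_arrow -> B;
  cp_src : cp_arrow -> cp_vertex;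
  cp_tgt : cp_arrow -> cp_vertex;
  cp_next : cp_arrow -> cp_arrow;
  cp_length : cp_arrow -> nat;
  cp_socle : cp_vertex -> B;
  cp_coef : cp_arrow -> nat -> B -> K;
  cp_scalarC : forall c b, cp_scalar c * b = b * cp_scalar c;
  cp_idem_neq0 : forall v, cp_idem v != 0;
  cp_idem_idem : forall v w,
    cp_idem v * cp_idem w = if v == w then cp_idem v else 0;
  cp_idem_elt : forall v a,
    cp_idem v * cp_elt a = if cp_src a == v then cp_elt a else 0;
  cp_elt_idem : forall v a,
    cp_elt a * cp_idem v = if cp_tgt a == v then cp_elt a else 0;
  cp_elt_elt : forall c a, c != cp_next a -> cp_elt c * cp_elt a = 0;
  cp_elt_socle : forall c v, cp_elt c * cp_socle v = 0;
  cp_chain_end : forall a,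
    arrow_chain cp_elt cp_next a (cp_length a) = cp_socle (cp_tgt a);
  cp_ind : forall Q : B -> Prop,
    (forall b b', Q b -> Q b' -> Q (b + b')) ->
    (forall c b, Q b -> Q (cp_scalar c * b)) ->
    Q 0 -> (forall v, Q (cp_idem v)) -> (forall a b, Q b -> Q (cp_elt a * b)) ->
    forall b, Q b;
  cp_coefD : forall a n, {morph cp_coef a n : b b' / b + b'};
  cp_coefZ : forall a n c b, cp_coef a n (cp_scalar c * b) = c * cp_coef a n b;
  cp_coef_chain : forall a n a' m, (n < cp_length a)%N ->
    cp_coef a n (arrow_chain cp_elt cp_next a' m) =
    ((a == a') && (n == m))%:R
}.

Section ChainPresentation.
Variables (K : fieldType) (B : pzRingType) (S : chain_presentation K B).

Local Notation kk := (cp_scalar S).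
Local Notation e := (@cp_idem K B S).
Local Notation x := (@cp_elt K B S).
Local Notation arrow := (cp_arrow S).
Local Notation vertex := (cp_vertex S).
Local Notation next := (@cp_next K B S).
Local Notation socle := (@cp_socle K B S).
Local Notation kC := (@cp_scalarC K B S).

Definition chain (a : arrow) (n : nat) : B := arrow_chain x next a n.

Lemma chainS a n : chain a n.+1 = x (iter n.+1 next a) * chain a n.
Proof. by []. Qed.

Lemma chain_head a n : exists z, chain a n = x (iter n next a) * z.
Proof.
by case: n => [|n]; [exists 1; rewrite mulr1|exists (chain a n)].
Qed.

Lemma elt_mul_chain c a n :
  x c * chain a n = if c == iter n.+1 next a then chain a n.+1 else 0.
Proof.
have [z zE] := chain_head a n.
by case: eqP => [->//|/eqP h]; rewrite zE mulrA cp_elt_elt ?mul0r.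
Qed.

Lemma idem_mul_chain v a n :
  e v * chain a n = if cp_src (iter n next a) == v then chain a n else 0.
Proof.
have [z ->] := chain_head a n.
by rewrite mulrA cp_idem_elt; case: ifP; rewrite ?mul0r.
Qed.

Lemma chain_socle a : chain a (cp_length a) = socle (cp_tgt a).
Proof. exact: cp_chain_end. Qed.

(** The chain of index [cp_length a] is a socle element and one further arrow kills it, hence the
    successor. *)
Definition chain_bound : nat := (\max_(a : arrow) cp_length a).+1.

Lemma chain0 a n : (chain_bound <= n)%N -> chain a n = 0.
Proof.
rewrite /chain_bound => h.
have {h} : (cp_length a < n)%N by apply: leq_ltn_trans h; exact: leq_bigmax.
elim: n => // n IH; rewrite ltnS leq_eqVlt => /orP[/eqP <-|/IH h].
  by rewrite chainS chain_socle cp_elt_socle.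
by rewrite chainS h mulr0.
Qed.

(** The hypothesis is the conclusion of [mul_chain] for one [b], so that this step can be used
    inside the induction that proves [mul_chain]. *)
Lemma elt_mul_mul_chain_of b a n d :
  (exists c r, b * chain a n = kk c * chain a n + r * chain a n.+1) ->
  exists r, x d * (b * chain a n) = r * chain a n.+1.
Proof.
move=> [c [r ->]]; rewrite mulrDr [x d * (kk c * _)]mulrA -kC -mulrA.
rewrite elt_mul_chain; case: ifP => _.
  by exists (kk c + x d * r); rewrite mulrDl mulrA.
by exists (x d * r); rewrite mulr0 add0r mulrA.
Qed.

(** An idempotent fixes or kills a chain, and an arrow prolongs or kills it. So modulo the next
    chain every element acts by a scalar, which is the source of uniseriality. *)
Lemma mul_chain b a n :
  exists c r, b * chain a n = kk c * chain a n + r * chain a n.+1.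
Proof.
elim/(@cp_ind K B S): b => [b b' [c [r E]] [c' [r' E']]|d b [c [r E]]||v|d b].
- by exists (c + c'), (r + r'); rewrite rmorphD !mulrDl E E' addrACA.
- by exists (d * c), (kk d * r); rewrite rmorphM -!mulrA E mulrDr.
- by exists 0, 0; rewrite rmorph0 !mul0r addr0.
- rewrite idem_mul_chain; case: ifP => _.
    by exists 1, 0; rewrite rmorph1 mul1r mul0r addr0.
  by exists 0, 0; rewrite rmorph0 !mul0r addr0.
move=> /(elt_mul_mul_chain_of d)[r E]; exists 0, r.
by rewrite rmorph0 mul0r add0r -mulrA.
Qed.

Lemma elt_mul_mul_chain d b a n :
  exists r, x d * (b * chain a n) = r * chain a n.+1.
Proof. exact/elt_mul_mul_chain_of/mul_chain. Qed.

Lemma arrow_sum_mul_mul_chain b a n :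
  exists r, (\sum_c x c) * (b * chain a n) = r * chain a n.+1.
Proof.
rewrite mulr_suml.
have /choice[r rE] d := elt_mul_mul_chain d b a n.
by exists (\sum_d r d); rewrite mulr_suml; apply: eq_bigr => d _.
Qed.

Lemma mul_chain_large b a n m :
  (n <= m)%N -> exists r, b * chain a m = r * chain a n.
Proof.
move=> /subnK <-; elim: (m - n)%N b => [|k IH] b; first by exists b.
by rewrite addSn chainS mulrA.
Qed.

Lemma mul_scalar_inv c z : c != 0 -> kk c^-1 * (kk c * z) = z.
Proof. by move=> c0; rewrite mulrA -rmorphM mulVf // rmorph1 mul1r. Qed.

Lemma chain_in_left_ideal a n c r : c != 0 ->
  exists u, chain a n = u * (kk c * chain a n + r * chain a n.+1).
Proof.
(* Descending induction on [n]; from [chain_bound] on all chains vanish. *)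
elim: {n}(chain_bound - n)%N {-2}n (leqnn (chain_bound - n)) c r => [|k IH] n.
  rewrite leqn0 subn_eq0 => h c r _.
  by exists 0; rewrite mul0r chain0.
move=> h c r c0; set y := _ + _.
(* Multiplication by the sum of all arrows shifts [y] to an element of the same form with index
   [n.+1] and the same leading scalar [c]. *)
have [r' r'E] := arrow_sum_mul_mul_chain r a n.+1.
have [|u uE] := IH n.+1 _ c r' c0; first by rewrite subnS -subn1 leq_subLR.
have chainT m : (\sum_d x d) * chain a m = chain a m.+1.
  rewrite mulr_suml (bigD1 (iter m.+1 next a)) //= big1 ?addr0 // => d /negPf dm.
  by rewrite elt_mul_chain dm.
have yT : (\sum_d x d) * y = kk c * chain a n.+1 + r' * chain a n.+2.
  rewrite mulrDr r'E; congr (_ + _).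
  by rewrite mulrA -kC -mulrA chainT.
(* Since [u] times the shifted [y] is [chain a n.+1], the term in [r] can be subtracted from [y];
   division by [c] remains. *)
exists (kk c^-1 * (1 - r * u * \sum_d x d)).
rewrite -mulrA mulrBl mul1r -[r * u * _ * y]mulrA yT -[r * u * _]mulrA -uE.
by rewrite /y addrK mul_scalar_inv.
Qed.

(* The power J^(n+1) of the ideal J generated by the arrows. *)
Definition arrow_ideal (n : nat) : set B :=
  [set b | exists f, b = \sum_a f a * chain a n].

Lemma arrow_ideal0 n : arrow_ideal n 0.
Proof. by exists (fun=> 0); rewrite big1 // => a _; rewrite mul0r. Qed.

Lemma arrow_idealD n b b' :
  arrow_ideal n b -> arrow_ideal n b' -> arrow_ideal n (b + b').
Proof.
move=> [f ->] [g ->]; exists (fun a => f a + g a); rewrite -big_split /=.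
by apply: eq_bigr => a _; rewrite mulrDl.
Qed.

Lemma arrow_idealM n b b' : arrow_ideal n b' -> arrow_ideal n (b * b').
Proof.
move=> [f ->]; exists (fun a => b * f a); rewrite mulr_sumr.
by apply: eq_bigr => a _; rewrite mulrA.
Qed.

Lemma arrow_ideal_sum n (I : Type) (r : seq I) (Q : pred I) (F : I -> B) :
  (forall i, Q i -> arrow_ideal n (F i)) ->
  arrow_ideal n (\sum_(i <- r | Q i) F i).
Proof.
move=> h; apply: big_ind => //; [exact: arrow_ideal0|exact: arrow_idealD].
Qed.

Lemma arrow_ideal_chain n b a : arrow_ideal n (b * chain a n).
Proof.
exists (fun a' => if a' == a then b else 0).
rewrite (bigD1 a) //= eqxx big1 ?addr0 // => a' /negPf ->.
by rewrite mul0r.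
Qed.

Lemma arrow_ideal_bound b : arrow_ideal chain_bound b -> b = 0.
Proof. by move=> [f ->]; rewrite big1 // => a _; rewrite chain0 ?mulr0. Qed.

(** The factor standing between an arrow and a chain is absorbed by [elt_mul_mul_chain]. *)
Lemma arrow_ideal_mul n b b' :
  arrow_ideal 0 b -> arrow_ideal n b' -> arrow_ideal n.+1 (b * b').
Proof.
move=> [f ->] [g ->]; rewrite mulr_suml; apply: arrow_ideal_sum => c _.
rewrite mulr_sumr; apply: arrow_ideal_sum => a _.
have [r E] := elt_mul_mul_chain c (g a) a n.
by rewrite -mulrA E mulrA; exact: arrow_ideal_chain.
Qed.

Lemma arrow_ideal_nilpotent b : arrow_ideal 0 b -> b ^+ chain_bound.+1 = 0.
Proof.
move=> Jb; apply: arrow_ideal_bound.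
by elim: chain_bound => // n IH; rewrite exprS; exact: arrow_ideal_mul.
Qed.

(** Division by [c] gives [1 - z] with [z] in the arrow ideal, hence nilpotent. *)
Lemma scalar_add_arrow_unit c b : c != 0 -> arrow_ideal 0 b ->
  exists u, u * (kk c + b) = 1.
Proof.
move=> c0 Jb.
have Jz : arrow_ideal 0 (- kk c^-1 * b) by exact: arrow_idealM.
have [u uE] := nilpotent_unit (arrow_ideal_nilpotent Jz).
exists (u * kk c^-1); rewrite -mulrA mulrDr -rmorphM mulVf // rmorph1.
by rewrite -[RHS]uE mulNr opprK.
Qed.

(** Modulo the arrow ideal only the idempotents remain; a nonzero [c v] will make an element
    invertible at [e v]. *)
Lemma idem_decomposition b : exists c : vertex -> K,
  exists2 b', arrow_ideal 0 b' & b = \sum_v kk (c v) * e v + b'.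
Proof.
elim/(@cp_ind K B S): b
  => [b b' [c [j Jj ->]] [c' [j' Jj' ->]]|d b [c [j Jj ->]]||v|a b [c [j Jj ->]]].
- exists (fun v => c v + c' v), (j + j'); first exact: arrow_idealD.
  rewrite addrACA -big_split /=; congr (_ + _); apply: eq_bigr => v _.
  by rewrite rmorphD mulrDl.
- exists (fun v => d * c v), (kk d * j); first exact: arrow_idealM.
  rewrite mulrDr mulr_sumr; congr (_ + _); apply: eq_bigr => v _.
  by rewrite rmorphM mulrA.
- exists (fun=> 0), 0; first exact: arrow_ideal0.
  by rewrite big1 ?addr0 // => v _; rewrite rmorph0 mul0r.
- exists (fun w => (w == v)%:R), 0; first exact: arrow_ideal0.
  rewrite addr0 (bigD1 v) //= eqxx rmorph1 mul1r big1 ?addr0 //.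
  by move=> w /negPf ->; rewrite rmorph0 mul0r.
exists (fun=> 0), (x a * (\sum_v kk (c v) * e v + j)); last first.
  by rewrite [X in _ = X + _]big1 ?add0r // => v _; rewrite rmorph0 mul0r.
rewrite mulrDr; apply: arrow_idealD; last exact: arrow_idealM.
rewrite mulr_sumr; apply: arrow_ideal_sum => v _.
rewrite mulrA -kC -mulrA cp_elt_idem; case: ifP => _.
  exact: (arrow_ideal_chain 0).
by rewrite mulr0; exact: arrow_ideal0.
Qed.

Definition chain_family (i : vertex + arrow * 'I_chain_bound) : B :=
  match i with inl v => e v | inr an => chain an.1 an.2 end.

(** Left multiplication by an arrow sends each member of the family to another member or to zero, so
    the span is a left ideal, and it contains the idempotents. *)
Lemma chain_family_span b : exists c, b = \sum_i kk (c i) * chain_family i.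
Proof.
have one i : exists c, chain_family i = \sum_j kk (c j) * chain_family j.
  exists (fun j => (j == i)%:R); rewrite (bigD1 i) //= eqxx rmorph1 mul1r.
  by rewrite big1 ?addr0 // => j /negPf ->; rewrite rmorph0 mul0r.
have add b1 b2 : (exists c, b1 = \sum_i kk (c i) * chain_family i) ->
    (exists c, b2 = \sum_i kk (c i) * chain_family i) ->
    exists c, b1 + b2 = \sum_i kk (c i) * chain_family i.
  move=> [c ->] [d ->]; exists (fun i => c i + d i).
  by rewrite -big_split; apply: eq_bigr => i _; rewrite rmorphD mulrDl.
have scale d b1 : (exists c, b1 = \sum_i kk (c i) * chain_family i) ->
    exists c, kk d * b1 = \sum_i kk (c i) * chain_family i.
  move=> [c ->]; exists (fun i => d * c i).
  by rewrite mulr_sumr; apply: eq_bigr => i _; rewrite rmorphM mulrA.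
have zero : exists c, 0 = \sum_i kk (c i) * chain_family i.
  by exists (fun=> 0); rewrite big1 // => i _; rewrite rmorph0 mul0r.
elim/(@cp_ind K B S): b => [//|//|//|v|a b [c ->]]; first exact: (one (inl v)).
rewrite mulr_sumr; apply: (big_ind (fun b => exists c, b = _)) => // i _.
rewrite mulrA -kC -mulrA; apply: scale; case: i => [v|[a' n]] /=.
  rewrite cp_elt_idem; case: ifP => // _.
  exact: (one (inr (a, ord0))).
rewrite elt_mul_chain; case: ifP => // _.
have [nM|/chain0 -> //] := ltnP n.+1 chain_bound.
exact: (one (inr (a', Ordinal nM))).
Qed.

Lemma coef_chain a n a' m : (n < cp_length a)%N ->
  cp_coef a n (chain a' m) = ((a == a') && (n == m))%:R.
Proof. exact: cp_coef_chain. Qed.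

Lemma coef0 a n : @cp_coef K B S a n 0 = 0.
Proof.
by rewrite -[X in cp_coef _ _ X](mulr0 (kk 0)) cp_coefZ mul0r.
Qed.

(** Descending induction on [m]: by [mul_chain] the product is a multiple of the chain, which the
    functional does not see, plus a multiple of the next one. *)
Lemma coef_mul_chain a n a' m b : (n < cp_length a)%N ->
  (a != a') || (n < m)%N -> cp_coef a n (b * chain a' m) = 0.
Proof.
move=> na; elim: {m}(chain_bound - m)%N {-2}m (leqnn (chain_bound - m)) b
  => [|k IH] m.
  by rewrite leqn0 subn_eq0 => h b _; rewrite chain0 // mulr0 coef0.
move=> h b am; have [c [r ->]] := mul_chain b a' m.
rewrite cp_coefD cp_coefZ coef_chain // IH.
- rewrite addr0; case/orP: am => [/negPf -> | nm]; first by rewrite mulr0.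
  by rewrite (ltn_eqF nm) andbF mulr0.
- by rewrite subnS -subn1 leq_subLR.
by case/orP: am => [-> //|nm]; rewrite (ltnW nm : (n < m.+1)%N) orbT.
Qed.

Lemma coef0_socle a b : (forall n, (n < cp_length a)%N -> cp_coef a n (b * x a) = 0) ->
  exists c, b * x a = kk c * socle (cp_tgt a).
Proof.
move=> h.
have : exists r, b * x a = r * chain a (cp_length a).
  (* Each vanishing coefficient pushes the product one index further along the chain, until the
     socle is reached. *)
  elim: {-2}(cp_length a) (leqnn (cp_length a)) => [_|n IH na]; first by exists b.
  have [r E] := IH (ltnW na); have [c [r' E']] := mul_chain r a n.
  have := h _ na; rewrite E E' cp_coefD cp_coefZ coef_chain // !eqxx mulr1.
  rewrite coef_mul_chain ?ltnSn ?orbT // addr0 => ->.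
  by exists r'; rewrite rmorph0 mul0r add0r.
move=> [r ->]; have [c [r' ->]] := mul_chain r a (cp_length a).
by exists c; rewrite chainS chain_socle cp_elt_socle mulr0 addr0.
Qed.

End ChainPresentation.

(** * Indecomposable projective modules and their radicals *)

Section ProjectiveModule.
Variables (K : fieldType) (B : pzRingType) (S : chain_presentation K B).
Variable P : lmodType B.

Local Notation kk := (cp_scalar S).
Local Notation e := (@cp_idem K B S).
Local Notation x := (@cp_elt K B S).
Local Notation arrow := (cp_arrow S).
Local Notation vertex := (cp_vertex S).
Local Notation socle := (@cp_socle K B S).
Local Notation kC := (@cp_scalarC K B S).
Local Notation J := (@arrow_ideal K B S).
Local Notation chain := (@chain K B S).

(** A Nakayama argument: if all coordinates lie in J, substituting the expansion of the elements
    into itself brings the coefficients into any given power of J. *)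
Lemma submodule_closed_arrow_ideal (f : P -> P -> B) :
  (forall q p, J 0 (f q p)) ->
  (forall p, exists d : {fset P}, p = \sum_(q <- d) f q p *: q) ->
  forall n (Q : set P), Q 0 -> (forall p q, Q p -> Q q -> Q (p + q)) ->
  (forall b p, J n b -> Q (b *: p)) -> forall p, Q p.
Proof.
move=> Jf fE; elim=> [|n IH] Q Q0 QD QJ p; have [d ->] := fE p.
  by apply: big_ind => // q _; apply: QJ.
apply: big_ind => // q _; move: (f q p) (Jf q p) => b Jb.
(* The elements [q] of the expansion are expanded in turn, under the coefficient [b]. *)
apply: (IH (fun q => Q (b *: q))) => [|p' q' Qp Qq|b' p' Jb'].
- by rewrite scaler0.
- by rewrite scalerDr; exact: QD.
by rewrite scalerA; apply/QJ/arrow_ideal_mul.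
Qed.

(** The clauses together say that [b |-> b *: p] induces an isomorphism from [B e_v] onto [P]. *)
Lemma projective_generator : projective P -> indecomposable P ->
  exists (v : vertex) (p : P),
    [/\ p <> 0, e v *: p = p, forall q, exists b, q = b *: p
      & forall b, b *: p = 0 -> b * e v = 0].
Proof.
move=> /projective_dual_basis[f fE] [P0 PI].
have [[q [p nJ]]|nex] := pselect (exists q p, ~ J 0 (f q p)); last first.
  (* With all coordinates in J, the Nakayama argument up to a vanishing power of J gives [P = 0]. *)
  case: P0; apply/seteqP; split=> // p _.
  apply: (@submodule_closed_arrow_ideal f _ fE (chain_bound S)) => //.
  - by move=> q p'; apply: contrapT => h; apply: nex; exists q, p'.
  - by move=> p1 p2 /= -> ->; rewrite addr0.
  by move=> b p' /arrow_ideal_bound ->; rewrite scale0r.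
have [c [j Jj bE]] := idem_decomposition S (f q p).
have [v cv] : exists v, c v != 0.
  apply: contrapT => h; apply: nJ; rewrite bE big1 ?add0r // => v _.
  have -> : c v = 0 by apply/eqP/negPn/negP => cv; apply: h; exists v.
  by rewrite rmorph0 mul0r.
have [u uE] := scalar_add_arrow_unit cv Jj.
have bv : (f q p : B) * e v = (kk (c v) + j) * e v.
  rewrite bE !mulrDl; congr (_ + _).
  rewrite mulr_suml (bigD1 v) //= big1 ?addr0 => [|w /negPf wv].
    by rewrite -mulrA cp_idem_idem eqxx.
  by rewrite -mulrA cp_idem_idem wv mulr0.
have ev : e v * e v = e v by rewrite cp_idem_idem eqxx.
(* [F] is a linear map from [P] to [B e_v], and [p1] is chosen with [F p1 = e v]. Hence [F] splits
   and [P] is the direct sum of [B p1] and the kernel of [F]. *)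
pose F r : B := (f q r : B) * e v.
have FD r r' : F (r + r') = F r + F r' by rewrite /F linearD mulrDl.
have FZ b r : F (b *: r) = b * F r by rewrite /F linearZ mulrA.
pose p1 := e v *: (u *: p).
have Fp1 : F p1 = e v by rewrite !FZ /F bv (mulrA u) uE mul1r.
have ep1 : e v *: p1 = p1 by rewrite /p1 scalerA ev.
have F0 : F 0 = 0 by rewrite -[in LHS](scale0r p1) FZ mul0r.
pose U : set P := [set r | exists b, r = b *: p1].
pose V : set P := [set r | F r = 0].
have p10 : p1 <> 0.
  by move=> h; move/eqP: (cp_idem_neq0 v); apply; rewrite -Fp1 h.
have [|||r|U0|V0] := PI U V.
- apply/submoduleP; split=> [|_ _ [b ->] [b' ->]|b _ [b' ->]].
  + by exists 0; rewrite scale0r.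
  + by exists (b + b'); rewrite scalerDl.
  by exists (b * b'); rewrite scalerA.
- apply/submoduleP; split=> [|r r' /= h h'|b r /= h] //; rewrite /V /=.
  + by rewrite FD h h' addr0.
  by rewrite FZ h mulr0.
- apply/seteqP; split=> [_ [[b ->] h]|_ ->] /=; last first.
    by split=> //; exists 0; rewrite scale0r.
  by move: h; rewrite /V /= FZ Fp1 -ep1 scalerA => ->; rewrite scale0r.
- exists (F r *: p1), (r - F r *: p1); split; first by exists (F r).
    by rewrite /V /= -scaleNr FD FZ Fp1 mulNr {2}/F -mulrA ev subrr.
  by rewrite addrC subrK.
- case: p10; have : U p1 by exists 1; rewrite scale1r.
  by rewrite U0.
exists v, p1; split=> // [r|b h]; last by rewrite -Fp1 -FZ h.
(* The kernel [V] of [F] is zero, so [r] equals its component in [B p1]. *)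
exists (F r); apply/eqP; rewrite -subr_eq0; apply/eqP.
suff : V (r - F r *: p1) by rewrite V0.
by rewrite /V /= -scaleNr FD FZ Fp1 mulNr {2}/F -mulrA ev subrr.
Qed.

Variables (v : vertex) (p : P).
Hypothesis p_neq0 : p <> 0.
Hypothesis idem_p : e v *: p = p.
Hypothesis gen_p : forall q, exists b, q = b *: p.
Hypothesis ann_p : forall b, b *: p = 0 -> b * e v = 0.

Definition arrow_submodule (a : arrow) : set P :=
  [set q | exists b, q = (b * x a) *: p].

Let radP : set P := [set q | exists2 b, J 0 b & q = b *: p].

Lemma radP_submodule : submodule radP.
Proof.
apply/submoduleP; split=> [|_ _ [b Jb ->] [b' Jb' ->]|b _ [b' Jb' ->]].
- by exists 0; [exact: arrow_ideal0|rewrite scale0r].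
- by exists (b + b'); [exact: arrow_idealD|rewrite scalerDl].
by exists (b * b'); [exact: arrow_idealM|rewrite scalerA].
Qed.

(** From [p = b *: p] follows [p = b ^+ n *: p] for all [n], while [b] is nilpotent. *)
Lemma generator_notin_rad : ~ radP p.
Proof.
move=> [b Jb pE]; apply: p_neq0.
have pX n : p = b ^+ n *: p.
  elim: n => [|n IH]; first by rewrite expr0 scale1r.
  by rewrite exprSr -scalerA -pE.
by rewrite (pX (chain_bound S).+1) arrow_ideal_nilpotent ?scale0r.
Qed.

(** An element outside [J p] is [b *: p] with [b] left invertible, so it generates [P]. Thus [J p]
    is the only maximal submodule. *)
Lemma proper_submodule_sub_rad (N : set P) :
  submodule N -> N <> setT -> N `<=` radP.
Proof.
move=> /submoduleP[N0 ND NZ] NT q Nq.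
have [b qE] := gen_p q; have [c [j Jj bE]] := idem_decomposition S b.
have {}qE : q = (kk (c v) + j) *: p.
  rewrite qE bE !scalerDl; congr (_ + _).
  rewrite -[in LHS]idem_p scalerA mulr_suml (bigD1 v) //=.
  rewrite big1 => [|w /negPf wv]; last by rewrite -mulrA cp_idem_idem wv mulr0.
  by rewrite addr0 -mulrA cp_idem_idem eqxx -scalerA idem_p.
have [cv|cv] := eqVneq (c v) 0.
  by exists j => //; rewrite qE cv rmorph0 add0r.
have [u uE] := scalar_add_arrow_unit cv Jj.
case: NT; apply/seteqP; split=> // r _; have [d ->] := gen_p r.
by apply: (NZ); rewrite -[p]scale1r -uE -scalerA -qE; exact: NZ.
Qed.

Lemma radP_maximal : maximal_submodule radP.
Proof.
split; first exact: radP_submodule.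
  by move=> h; apply: generator_notin_rad; rewrite h.
move=> N Nsub rN; have [NT|NT] := pselect (N = setT); first by right.
by left; apply/seteqP; split=> //; exact: proper_submodule_sub_rad.
Qed.

Lemma module_radE : @module_rad B P = radP.
Proof.
apply/seteqP; split=> [q|q rq N [Nsub NT Nmax]]; first by apply; exact: radP_maximal.
have [<- //|rT] := Nmax _ radP_submodule (proper_submodule_sub_rad Nsub NT).
by case: generator_notin_rad; rewrite rT.
Qed.

Lemma arrow_submodule_submodule a : submodule (arrow_submodule a).
Proof.
apply/submoduleP; split=> [|_ _ [b ->] [b' ->]|b _ [b' ->]].
- by exists 0; rewrite mul0r scale0r.
- by exists (b + b'); rewrite mulrDl scalerDl.
by exists (b * b'); rewrite scalerA mulrA.
Qed.

(* Hence every submodule of an arrow submodule is a truncation of its chain. *)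
Lemma arrow_submodule_cyclic a q : arrow_submodule a q ->
  q = 0 \/ exists n, (exists u, q = u *: (chain a n *: p)) /\
                     (exists u, chain a n *: p = u *: q).
Proof.
(* The claim is generalized to multiples of a chain of any index [n], for a descending induction on
   [n]. *)
suff h k n b : (chain_bound S - n <= k)%N -> b * chain a n = 0 \/
    exists m, (exists u, b * chain a n = u * chain a m) /\
              (exists u, chain a m = u * (b * chain a n)).
  move=> [b ->]; have [->|[m [[u uE] [w wE]]]] := h _ 0 b (leqnn _).
    by left; rewrite scale0r.
  right; exists m; split; first by exists u; rewrite scalerA -uE.
  by exists w; rewrite scalerA -wE.
elim: k n b => [|k IH] n b.
  by rewrite leqn0 subn_eq0 => nb; left; rewrite chain0 ?mulr0.
move=> nk; have [c [r E]] := mul_chain b a n.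
(* If the scalar vanishes the element is a multiple of the next chain; otherwise it generates the
   same left ideal as the present one. *)
have [c0|c0] := eqVneq c 0.
  have {}E : b * chain a n = r * chain a n.+1.
    by rewrite E c0 rmorph0 mul0r add0r.
  by rewrite E; apply: IH; rewrite subnS -subn1 leq_subLR.
have [u uE] := chain_in_left_ideal a n r c0.
by right; exists n; split; [exists b|exists u; rewrite E].
Qed.

Lemma arrow_submodule_uniserial a : uniserial (arrow_submodule a).
Proof.
split; first exact: arrow_submodule_submodule.
move=> V W /submoduleP[V0 VD VZ] /submoduleP[W0 WD WZ] VU WU.
have [VW|nVW] := pselect (V `<=` W); [by left|right => w Ww].
have [y [Vy nWy]] : exists y, V y /\ ~ W y.
  apply: contrapT => h; apply: nVW => y Vy.
  by apply: contrapT => nWy; apply: h; exists y.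
have [y0|[n [[u uE] [u' u'E]]]] := arrow_submodule_cyclic (VU _ Vy).
  by case: nWy; rewrite y0.
have [->//|[m [[t tE] [t' t'E]]]] := arrow_submodule_cyclic (WU _ Ww).
(* The submodules generated by the chains are nested: for [n <= m], [w] is a multiple of [y] and
   lies in [V]; for [m < n], [y] would be a multiple of [w] and lie in [W]. *)
have [nm|/ltnW mn] := leqP n m.
  have [r rE] := mul_chain_large (1 : B) a nm; rewrite mul1r in rE.
  by rewrite tE rE -scalerA u'E; do 3!apply: (VZ).
have [r rE] := mul_chain_large (1 : B) a mn; rewrite mul1r in rE.
by case: nWy; rewrite uE rE -scalerA t'E; do 3!apply: (WZ).
Qed.

Lemma arrow_submodule_inter a a' q : a != a' ->
  arrow_submodule a q -> arrow_submodule a' q ->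
  exists c, q = (kk c * socle v) *: p.
Proof.
move=> aa' [b qE] [b' qE'].
(* Unless [cp_tgt a] is [v], already [x a *: p = 0]; likewise for [a']. *)
have [av|/negPf av] := eqVneq (cp_tgt a) v; last first.
  exists 0; rewrite qE rmorph0 mul0r scale0r -idem_p scalerA -mulrA cp_elt_idem.
  by rewrite av mulr0 scale0r.
have [a'v|/negPf a'v] := eqVneq (cp_tgt a') v; last first.
  exists 0; rewrite qE' rmorph0 mul0r scale0r -idem_p scalerA -mulrA cp_elt_idem.
  by rewrite a'v mulr0 scale0r.
(* The equality in [P] lifts to [B]. As [x a'] is a chain from another arrow, the functionals at [a]
   vanish on both sides, and only the socle is left. *)
have E : b * x a = b' * x a'.
  apply/eqP; rewrite -subr_eq0; apply/eqP.
  have /ann_p : (b * x a - b' * x a') *: p = 0 by rewrite scalerBl -qE -qE' subrr.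
  by rewrite mulrBl -!mulrA !cp_elt_idem av a'v eqxx.
have [n na|c cE] := @coef0_socle K B S a b.
  by rewrite E; apply: (@coef_mul_chain K B S a n a' 0); rewrite ?aa'.
by exists c; rewrite qE cE av.
Qed.

(** The intersection lies in the [K]-line through [socle v *: p], so each of its elements is a
    scalar multiple of any nonzero one. *)
Lemma arrow_submodule_inter_simple a a' : a != a' ->
  arrow_submodule a `&` arrow_submodule a' = [set 0] \/
  simple_submodule (arrow_submodule a `&` arrow_submodule a').
Proof.
move=> aa'; have [h|h] := pselect (arrow_submodule a `&` arrow_submodule a' = [set 0]).
  by left.
have [/submoduleP[U0 UD UZ] /submoduleP[U'0 U'D U'Z]] :=
  (arrow_submodule_submodule a, arrow_submodule_submodule a').
right; split=> //.
  apply/submoduleP; split=> // [y z [Uy U'y] [Uz U'z]|c y [Uy U'y]].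
  - by split; [exact: UD|exact: U'D].
  by split; [exact: UZ|exact: U'Z].
move=> V /submoduleP[V0 VD VZ] VU.
have [Vz|nVz] := pselect (V `<=` [set 0]).
  by left; apply/seteqP; split=> // _ ->.
right; apply/seteqP; split=> // y [Uy U'y].
have [z Vz z0] : exists2 z, V z & z <> 0.
  apply: contrapT => nz; apply: nVz => z Vz; apply: contrapT => z0.
  by apply: nz; exists z.
have [Uz U'z] := VU _ Vz.
have [c yE] := arrow_submodule_inter aa' Uy U'y.
have [d zE] := arrow_submodule_inter aa' Uz U'z.
have d0 : d != 0.
  by apply/eqP => d0; apply: z0; rewrite zE d0 rmorph0 mul0r scale0r.
suff -> : y = (kk c * kk d^-1) *: z by apply: VZ.
by rewrite yE zE scalerA -mulrA mul_scalar_inv.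
Qed.

(** All arrows serve as indices; those with [cp_tgt a != v] contribute the zero submodule, which is
    uniserial. *)
Lemma generated_multiserial_rad : multiserial_rad P.
Proof.
exists #|arrow|, (fun i => arrow_submodule (enum_val i)); rewrite module_radE.
split=> [i||i j ij].
- split; first exact: arrow_submodule_uniserial.
  move=> _ [b ->]; exists (b * x (enum_val i)) => //.
  exact: (@arrow_ideal_chain K B S 0).
- apply/seteqP; split=> [_ [_ [f ->] ->]|q [u [Uu ->]]].
    exists (fun i => (f (enum_val i) * x (enum_val i)) *: p); split.
      by move=> i; exists (f (enum_val i)).
    rewrite scaler_suml [LHS](reindex (@enum_val arrow predT)) //=.
    exact/onW_bij/enum_val_bij.
  have /submoduleP[r0 rD rZ] := radP_submodule.
  apply: big_ind => // i _; have [b ->] := Uu i.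
  by exists (b * x (enum_val i)) => //; exact: (@arrow_ideal_chain K B S 0).
apply: arrow_submodule_inter_simple; apply: contra ij => /eqP h.
by apply/eqP/enum_val_inj.
Qed.

End ProjectiveModule.

Lemma chain_presentation_multiserial_rad (K : fieldType) (B : pzRingType)
    (S : chain_presentation K B) (P : lmodType B) :
  projective P -> indecomposable P -> multiserial_rad P.
Proof.
move=> proj ind; have [v [p [p0 ep gp ap]]] := projective_generator S proj ind.
exact: generated_multiserial_rad p0 ep gp ap.
Qed.

(** * Finite spanning families and finite dimension *)

(** A spanning family of minimal size is a basis, since a nontrivial relation would allow one member
    to be dropped. *)
Lemma finite_span_finite_dimensional (K : fieldType) (V : lmodType K)
    (I : finType) (g : I -> V) :
  (forall v, exists c, v = \sum_i c i *: g i) -> finite_dimensional V.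
Proof.
move=> gspan.
have ex : exists m, `[< exists h : 'I_m -> V,
    forall v, exists c, v = \sum_i c i *: h i >].
  exists #|I|; apply/asboolP; exists (g \o enum_val) => v.
  have [c ->] := gspan v; exists (c \o enum_val).
  by rewrite (reindex (@enum_val I predT)) //=; exact/onW_bij/enum_val_bij.
case: (ex_minnP ex) => m /asboolP[h hspan] hmin {ex gspan}.
pose f (u : 'rV[K]_m) := \sum_i u 0 i *: h i.
have fB u w : f (u - w) = f u - f w.
  rewrite /f -sumrB; apply: eq_bigr => i _.
  by rewrite !mxE scalerBl.
have f0 u : f u = 0 -> u = 0.
  move=> fu; apply/rowP => i; rewrite mxE; apply/eqP/negPn/negP => ui.
  case: m h hspan hmin @f fB u fu i ui => [|m] h hspan hmin f fB u fu i ui.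
    by case: i ui.
  suff : (m.+1 <= m)%N by rewrite ltnn.
  apply: hmin; apply/asboolP; exists (h \o lift i) => v.
  have [c ->] := hspan v.
  (* These coefficients arise when [h i] is eliminated by means of the relation [u]. *)
  exists (fun j => c (lift i j) - c i * (u 0 i)^-1 * u 0 (lift i j)).
  have hi : h i = - \sum_j ((u 0 i)^-1 * u 0 (lift i j)) *: h (lift i j).
    move: fu; rewrite /f (bigD1_ord i) //= => /eqP; rewrite addr_eq0 => /eqP E.
    rewrite -[LHS]scale1r -(mulVf ui) -scalerA E scalerN scaler_sumr.
    by congr (- _); apply: eq_bigr => j _; rewrite scalerA.
  rewrite (bigD1_ord i) //= hi scalerN scaler_sumr -sumrN -big_split /=.
  apply: eq_bigr => j _; rewrite scalerA -scaleNr -scalerDl; congr (_ *: _).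
  by rewrite addrC mulrA.
have /choice[r rK] v : exists u, f u = v.
  have [c ->] := hspan v; exists (\row_i c i).
  by apply: eq_bigr => i _; rewrite mxE.
have fK : cancel f r.
  by move=> u; apply/eqP; rewrite -subr_eq0; apply/eqP/f0; rewrite fB rK subrr.
exists m; constructor; exists r; last by exists f.
move=> c u w; apply: (can_inj fK); rewrite rK.
have -> : f (c *: r u + r w) = c *: f (r u) + f (r w); last by rewrite !rK.
rewrite /f scaler_sumr -big_split /=; apply: eq_bigr => i _.
by rewrite !mxE scalerDl scalerA.
Qed.

(** * Products of arrows in a path algebra *)

Section PathWords.
Variables (K : fieldType) (Q : quiver).

Local Notation KQ := (path_algebra K Q).
Local Notation arr := (@arrow_elt K Q).
Local Notation triv v := (path_elt K (@trivial_path Q v) : KQ).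

(** Words need not be walks: a word that is not one has product zero, and the empty word gives [1],
    the sum of all trivial paths. *)
Definition word_elt (s : seq (qarrow Q)) : KQ := \prod_(a <- s) arr a.

Lemma path_elt_mul (p q : qpath Q) :
  (path_elt K p : KQ) * path_elt K q = opath_elt K (Defs.pcomp p q).
Proof. exact: pa_muluu. Qed.

Lemma triv_mul_triv v w : triv v * triv w = if v == w then triv v else 0.
Proof.
rewrite path_elt_mul pcomp_trivl /pstart /=.
by case: eqP => // ->.
Qed.

Lemma triv_mul_arr v a : triv v * arr a = if qsrc a == v then arr a else 0.
Proof.
rewrite path_elt_mul pcomp_trivl /pstart /= eq_sym.
by case: eqP.
Qed.

Lemma arr_mul_triv a v : arr a * triv v = if qtgt a == v then arr a else 0.
Proof.
rewrite path_elt_mul pcomp_trivr /pend /= eq_sym.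
by case: eqP.
Qed.

Lemma arr_mul_arr a b : qtgt a != qsrc b -> arr a * arr b = 0.
Proof.
by move=> ab; rewrite path_elt_mul /Defs.pcomp /pend /= (negPf ab).
Qed.

(** The trivial path in front makes the formula hold for paths of length zero too. *)
Lemma path_eltE (p : qpath Q) :
  path_elt K p = triv (pstart p) * word_elt (parrows p).
Proof.
case: p => -[v s] w; rewrite /pstart /parrows /=.
elim: s v w => [|a s IH] v w.
  by rewrite /word_elt big_nil mulr1; congr path_elt; apply/val_inj.
have /andP[/eqP av w'] : (qsrc a == v) && is_walk (qtgt a) s := w.
rewrite /word_elt big_cons mulrA triv_mul_arr av eqxx.
have -> : arr a = arr a * triv (qtgt a) by rewrite arr_mul_triv eqxx.
rewrite -mulrA -[\prod_(_ <- _) _]/(word_elt s) -(IH _ w') path_elt_mul.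
have [|r -> [rs ra _]] := @pcompP Q (arrow_path a) (@QPath Q (qtgt a, s) w').
  by [].
by congr path_elt; apply: qpath_eq; rewrite ?rs ?ra //= -av.
Qed.

Lemma word_eltE (p : qpath Q) : parrows p != [::] ->
  word_elt (parrows p) = path_elt K p.
Proof.
rewrite path_eltE; case: p => -[v [|a s]] // w _; rewrite /pstart /parrows /=.
have /andP[/eqP <- _] : (qsrc a == v) && is_walk (qtgt a) s := w.
by rewrite /word_elt big_cons mulrA triv_mul_arr eqxx.
Qed.

Lemma path_elt_coef (p q : qpath Q) : (path_elt K p)@_q = (p == q)%:R.
Proof. by rewrite path_elt.unlock; exact: mcoeffU. Qed.

(** Paths grow at the front here and at the back in [path_algebra_ind_r]; the first form serves the
    algebra, the second its opposite. *)
Lemma path_algebra_ind_l (X : KQ -> Prop) :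
  (forall g h, X g -> X h -> X (g + h)) -> (forall c g, X g -> X (c *: g)) ->
  X 0 -> (forall v, X (triv v)) -> (forall a g, X g -> X (arr a * g)) ->
  forall g, X g.
Proof.
move=> XD XZ X0 Xe Xa; elim/pa_ind => // p; rewrite path_eltE.
case: p => -[v s] w; rewrite /pstart /parrows /= {w}.
elim: s v => [|a s IH] v; first by rewrite /word_elt big_nil mulr1.
rewrite /word_elt big_cons mulrA triv_mul_arr; case: ifP; rewrite ?mul0r // => _.
have -> : arr a = arr a * triv (qtgt a) by rewrite arr_mul_triv eqxx.
by rewrite -mulrA; apply: Xa; exact: IH.
Qed.

Lemma path_algebra_ind_r (X : KQ -> Prop) :
  (forall g h, X g -> X h -> X (g + h)) -> (forall c g, X g -> X (c *: g)) ->
  X 0 -> (forall v, X (triv v)) -> (forall a g, X g -> X (g * arr a)) ->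
  forall g, X g.
Proof.
move=> XD XZ X0 Xe Xa; elim/pa_ind => // p; rewrite path_eltE.
case: p => -[v s] w; rewrite /pstart /parrows /= {w}.
elim/last_ind: s => [|s a IH]; first by rewrite /word_elt big_nil mulr1.
by rewrite /word_elt -cats1 big_cat /= big_seq1 mulrA; exact: Xa.
Qed.

(** Factors of good words are good, so a path with a bad factor is bad and the bad paths span an
    ideal. *)
Lemma path_coef0_ideal (good : pred (seq (qarrow Q))) :
  (forall s t, good (s ++ t) -> good s /\ good t) ->
  two_sided_ideal [set x : KQ | forall p, good (parrows p) -> x@_p = 0].
Proof.
move=> good_cat.
have compgood p q r : Defs.pcomp p q = Some r -> good (parrows r) ->
    good (parrows p) /\ good (parrows q).
  have [/Defs.pcompP[r' -> [_ ra _]]|/eqP/negPf h] := pselect (pend p = pstart q).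
    by case=> <-; rewrite ra; exact: good_cat.
  by rewrite /Defs.pcomp h.
have mul0 (x y : KQ) r : (forall p q, Defs.pcomp p q = Some r -> x@_p * y@_q = 0) ->
    (x * y : KQ)@_r = 0.
  move=> h; rewrite -[x * y]/(pa_mul x y) pa_mul.unlock raddf_sum big1 // => p _.
  rewrite raddf_sum big1 // => q _; rewrite /= pa_coeffZ.
  case E : (Defs.pcomp p q) => [r'|] /=; last by rewrite mcoeff0 mulr0.
  rewrite path_elt_coef; case: eqP => [rr|_]; last by rewrite mulr0.
  by rewrite h ?mul0r // E rr.
split=> [p _|x y Jx Jy p gp|a x Jx r gr|a x Jx r gr].
- exact: mcoeff0.
- by rewrite mcoeffB Jx // Jy // subrr.
- by apply: mul0 => p q /compgood[//|_ gq]; rewrite Jx // mulr0.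
by apply: mul0 => p q /compgood[//|gp _]; rewrite Jx // mul0r.
Qed.

End PathWords.

(** * The successor map, good words and the ideal of relations *)

Section BrauerQuiver.
Variables (K : fieldType) (G : brauer_configuration).

Local Notation Q := (brauer_quiver G).
Local Notation KQ := (path_algebra K Q).
Local Notation next := (@barrow_next G).
Local Notation arr := (@arrow_elt K Q).
Local Notation word := (@word_elt K Q).

(** The number of letters of [C ^+ mu] for the special cycle [C] at [a]. *)
Definition cycle_length (a : barrow G) : nat :=
  (bval (avertex a) * bmult (avertex a))%N.

Lemma bmult_gt0 (z : bvertex G) : (0 < bmult z)%N.
Proof. by case: G z. Qed.

Lemma card_occurrence (z : bvertex G) :
  #|{: occurrence (@polygon G) z}| = bval z.
Proof.
rewrite card_tagged /bval /valency sumnE big_map big_enum /=.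
by apply: eq_bigr => V _; rewrite card_ord.
Qed.

Lemma iter_next a n :
  val (iter n next a) = Tagged (occurrence (@polygon G))
    (iter n (orientation (avertex a)) (aocc a)).
Proof.
pose f (u : {z : bvertex G & occurrence (@polygon G) z}) :=
  Tagged (occurrence (@polygon G)) (orientation (tag u) (tagged u)).
elim: n => [|n IH]; first by case: a => -[].
by rewrite iterS -[LHS]/(f (val (iter n next a))) IH.
Qed.

(** The orientation has a single cycle, so its orbit contains all [bval] occurrences. *)
Lemma iter_next_bval a : iter (bval (avertex a)) next a = a.
Proof.
apply/val_inj; rewrite iter_next -card_occurrence.
have -> : #|{: occurrence (@polygon G) (avertex a)}| =
    #|porbit (orientation (avertex a)) (aocc a)|.
  apply: eq_card => o; rewrite inE; apply: esym.
  by case: G a o => ? ? ? ? ori ? single ? ? ? a o; exact: single.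
by rewrite iter_porbit; case: a => -[].
Qed.

Lemma avertex_iter n a : avertex (iter n next a) = avertex a.
Proof. by elim: n. Qed.

Lemma bval_gt0 (a : barrow G) : (0 < bval (avertex a))%N.
Proof. by rewrite -card_occurrence; apply/card_gt0P; exists (aocc a). Qed.

Lemma cycle_length_gt0 a : (0 < cycle_length a)%N.
Proof. by rewrite /cycle_length muln_gt0 bval_gt0 bmult_gt0. Qed.

Lemma cycle_length_next n a : cycle_length (iter n next a) = cycle_length a.
Proof. by rewrite /cycle_length avertex_iter. Qed.

Lemma iter_next_cycle a : iter (cycle_length a) next a = a.
Proof.
rewrite /cycle_length mulnC; elim: (bmult _) => // k IH.
by rewrite mulSn addnC iterD iter_next_bval.
Qed.

(** Going on around the closed cycle undoes [next], and the number of steps needed is constant along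
    the orbit. *)
Lemma barrow_next_inj : injective next.
Proof.
have key a : a = iter (cycle_length a).-1 next (next a).
  by rewrite -iterSr prednK ?cycle_length_gt0 ?iter_next_cycle.
move=> a b ab; rewrite (key a) (key b) -ab; congr iter.
by rewrite -(cycle_length_next 1 a) /= ab (cycle_length_next 1 b).
Qed.

Definition barrow_prev : barrow G -> barrow G := finv next.

Local Notation prev := barrow_prev.

Lemma barrow_nextK : cancel next prev. Proof. exact: finv_f barrow_next_inj. Qed.
Lemma barrow_prevK : cancel prev next. Proof. exact: f_finv barrow_next_inj. Qed.

Lemma iter_prevK n : cancel (iter n prev) (iter n next).
Proof. by elim: n => // n IH a; rewrite iterSr [iter _ prev a]iterS barrow_prevK. Qed.

Lemma iter_nextK n : cancel (iter n next) (iter n prev).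
Proof. by elim: n => // n IH a; rewrite iterSr [iter _ next a]iterS barrow_nextK. Qed.

Lemma cycle_length_prev n a : cycle_length (iter n prev a) = cycle_length a.
Proof. by rewrite -[in RHS](iter_prevK n a) cycle_length_next. Qed.

Definition chain_word (a : barrow G) (n : nat) : seq (qarrow Q) :=
  traject next a n.

Lemma chain_word_walk a n : is_walk (qsrc (a : qarrow Q)) (chain_word a n.+1).
Proof. by elim: n a => [|n IH] a; rewrite /= eqxx //; exact: IH. Qed.

(** As in [arrow_chain], index [n] means [n.+1] letters, so the path is never trivial. *)
Definition chain_path (a : barrow G) (n : nat) : qpath Q :=
  @QPath Q (qsrc (a : qarrow Q), chain_word a n.+1) (chain_word_walk a n).

Lemma chain_word_elt a n : word (chain_word a n.+1) = path_elt K (chain_path a n).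
Proof. exact: (@word_eltE K Q (chain_path a n)). Qed.

Lemma chain_path_inj a b m n :
  chain_path a m = chain_path b n -> a = b /\ m = n.
Proof.
by move=> /(congr1 val)[_ -> /(congr1 size)]; rewrite !size_traject.
Qed.

Lemma word_cat s t : word (s ++ t) = word s * word t.
Proof. exact: big_cat. Qed.

Lemma special_cycle_power a :
  special_cycle_elt K a ^+ bmult (avertex a) = word (chain_word a (cycle_length a)).
Proof.
rewrite /cycle_length; elim: (bmult _) => [|k IH].
  by rewrite muln0 expr0 /word_elt big_nil.
rewrite exprS IH -[special_cycle_elt K a]/(word (special_cycle a)) -word_cat.
by rewrite mulnS /chain_word trajectD iter_next_bval.
Qed.

(** The bound is strict because the relations of type one identify the full cycles [C ^+ mu] at a
    vertex. The empty word is good. *)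
Definition good_word (s : seq (qarrow Q)) : bool :=
  if s is a :: t then fpath next a t && (size s < cycle_length a)%N else true.

Lemma fpath_cycle_length a s b :
  fpath next a s -> b \in (a :: s) -> cycle_length b = cycle_length a.
Proof.
move=> /fpathP[n ->]; rewrite -trajectS => /trajectP[i _ ->].
exact: cycle_length_next.
Qed.

Lemma good_word_cat s t : good_word (s ++ t) -> good_word s /\ good_word t.
Proof.
case: s => [|a s] //; rewrite cat_cons /= => /andP[p sz]; split.
  move: p; rewrite cat_path => /andP[-> _] /=.
  by apply: leq_ltn_trans sz; rewrite ltnS size_cat leq_addr.
case: t p sz => [|b t] // p sz.
have bs : b \in a :: s ++ b :: t by rewrite inE mem_cat inE eqxx !orbT.
rewrite /= (fpath_cycle_length p bs).
move: p; rewrite cat_path /= => /and3P[_ _ ->] /=.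
by apply: leq_ltn_trans sz; apply: leqW; rewrite size_cat leq_addl.
Qed.

Lemma chain_word_good a n : good_word (chain_word a n) = (n < cycle_length a)%N.
Proof.
case: n => [|n]; first by rewrite cycle_length_gt0.
by rewrite /= size_traject fpath_traject.
Qed.

Lemma infix_traject (a b c : barrow G) n :
  infix [:: a; b] (traject next c n) -> b = next a.
Proof.
elim: n c => [|n IH] c //= /orP[|]; last exact: IH.
by case: n {IH} => [|n] /=; rewrite ?andbF // => /and3P[/eqP -> /eqP ->].
Qed.

(** For [bval] at least two, the subpaths of length two of special cycles are the pairs of
    successive arrows. For [bval] one, the special cycle is a single loop; nontruncation forces
    [mu > 1], so its square is the excepted path. *)
Lemma type_threeP (z : KQ) : type_three z <->
  exists a b : qarrow Q, [/\ qtgt a = qsrc b, b <> next a & z = arr a * arr b].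
Proof.
split=> [[a [b [ab nab h ->]]]|[a [b [ab nab ->]]]]; exists a, b; split=> //.
- move=> bE; apply: h; have [v1|v1] := eqVneq (bval (avertex a)) 1%N.
    have aE : next a = a by rewrite -[RHS]iter_next_bval v1.
    split=> //; first by rewrite bE aE.
    rewrite ltn_neqAle eq_sym bmult_gt0 andbT.
    apply/eqP => m1; have := valP (a : barrow G).
    by rewrite /truncated -/(avertex a) v1 m1.
  have v2 : (1 < bval (avertex a))%N.
    by rewrite ltn_neqAle eq_sym v1 bval_gt0.
  case/negP: (nab a); rewrite bE /special_cycle.
  by case: (bval _) v2 => [|[|n]] //= _; rewrite !eqxx prefix0s.
- by move=> c; apply/negP => /infix_traject.
move=> [E v1 _]; apply: nab; rewrite -E -[in LHS](iter_next_bval a).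
by rewrite v1.
Qed.

(** Every path in a generator is bad: in types one and two it is too long, in type three the second
    arrow is not the successor of the first. *)
Lemma ideal_coef0 (z : KQ) (p : qpath Q) :
  ideal_gen (@type_one K G `|` @type_two K G `|` @type_three K G) z ->
  good_word (parrows p) -> z@_p = 0.
Proof.
move=> zI gp; pose J := [set z : KQ | forall p, good_word (parrows p) -> z@_p = 0].
have cyc a n : (cycle_length a <= n)%N -> J (word (chain_word a n)).
  move=> an q gq; have n0 := leq_trans (cycle_length_gt0 a) an.
  rewrite -(prednK n0) chain_word_elt path_elt_coef; case: eqP => // pq.
  move: gq; rewrite -pq -[good_word _]/(good_word (chain_word a n.-1.+1)).
  by rewrite chain_word_good prednK // ltnNge an.
have [_ JIB _ _] := path_coef0_ideal K good_word_cat.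
apply: (zI J _ p gp); split; first exact: path_coef0_ideal good_word_cat.
move=> y [[[a [b [_ ->]]]|[a ->]]|/type_threeP[a [b [ab nab ->]]]].
- by rewrite !special_cycle_power; apply: JIB; exact: cyc.
- rewrite special_cycle_power.
  (* The arrow that follows the full cycle is [a] again, so the generator is a chain with one letter
     more than the cycle. *)
  have -> : arr a = word [:: iter (cycle_length a) next a].
    by rewrite iter_next_cycle /word_elt big_seq1.
  by rewrite -word_cat cats1 -trajectSr; exact: (cyc a (cycle_length a).+1 (leqnSn _)).
move=> q gq.
have w : is_path (qsrc a, [:: a; b]) by apply/and3P; split; [exact: eqxx|exact/eqP|].
have -> : arr a * arr b = word [:: a; b] by rewrite /word_elt big_cons big_seq1.
rewrite (@word_eltE K Q (QPath w)) // path_elt_coef; case: eqP => // pq.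
by case: nab; move: gq; rewrite -pq /parrows /= => /andP[/andP[/eqP]].
Qed.

End BrauerQuiver.

(** * The Brauer configuration algebra and its opposite as chain presentations *)

Section BrauerPresentation.
Variables (K : fieldType) (G : brauer_configuration).

Local Notation Q := (brauer_quiver G).
Local Notation KQ := (path_algebra K Q).
Local Notation next := (@barrow_next G).
Local Notation prev := (@barrow_prev G).
Local Notation rels := (@type_one K G `|` @type_two K G `|` @type_three K G).
Local Notation A := (alg_ring (brauer_algebra K G)).

Definition brauer_pi (g : KQ) : A := quot_pi rels g.
HB.instance Definition _ := GRing.isZmodMorphism.Build KQ A brauer_pi
  (@quot_pi_is_zmod_morphism _ rels).
HB.instance Definition _ := GRing.isMonoidMorphism.Build KQ A brauer_pi
  (@quot_pi_is_monoid_morphism _ rels).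

Local Notation scalar := (alg_map (brauer_algebra K G)).

Definition brauer_idem (v : qvertex Q) : A := brauer_pi (path_elt K (trivial_path v)).
Definition brauer_arrow (a : qarrow Q) : A := brauer_pi (arrow_elt K a).
Definition brauer_word (s : seq (qarrow Q)) : A := brauer_pi (word_elt K s).

Local Notation e := brauer_idem.
Local Notation x := brauer_arrow.
Local Notation word := brauer_word.

Lemma brauer_pi_eq0 g : rels g -> brauer_pi g = 0.
Proof.
move=> rg; rewrite -(rmorph0 brauer_pi); apply/quot_piP; rewrite subr0.
by move=> J [_]; apply.
Qed.

Lemma brauer_piZ c g : brauer_pi (c *: g) = scalar c * brauer_pi g.
Proof.
rewrite -[scalar c]/(brauer_pi (pa_scalar Q c)) -rmorphM; congr brauer_pi.
by rewrite -[RHS]/(pa_mul _ _) pa_mulZl [pa_mul _ _]pa_mul1l.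
Qed.

Lemma brauer_word_cons a s : word (a :: s) = x a * word s.
Proof. by rewrite /word /word_elt big_cons rmorphM. Qed.

Lemma brauer_word_rcons s a : word (rcons s a) = word s * x a.
Proof. by rewrite /word /word_elt -cats1 big_cat big_seq1 rmorphM. Qed.

Lemma brauer_word1 a : word [:: a] = x a.
Proof. by rewrite /word /word_elt big_seq1. Qed.

Lemma brauer_word_cycle (a b : qarrow Q) : qsrc a = qsrc b ->
  word (chain_word a (cycle_length a)) = word (chain_word b (cycle_length b)).
Proof.
move=> ab; apply/eqP; rewrite -subr_eq0 -rmorphB -!special_cycle_power; apply/eqP.
by apply: brauer_pi_eq0; left; left; exists a, b.
Qed.

Lemma brauer_cycle_arrow a : word (chain_word a (cycle_length a)) * x a = 0.
Proof.
rewrite -rmorphM -special_cycle_power; apply: brauer_pi_eq0.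
by left; right; exists a.
Qed.

(** [a] followed by the full cycle at [next a] is the same word as the full cycle at [a] followed by
    [a]. *)
Lemma brauer_arrow_cycle a : x a * word (chain_word (next a) (cycle_length a)) = 0.
Proof.
rewrite -brauer_word_cons -[_ :: _]/(traject next a (cycle_length a).+1) trajectSr.
by rewrite brauer_word_rcons iter_next_cycle brauer_cycle_arrow.
Qed.

Lemma brauer_arrow_arrow (a b : qarrow Q) : b != next a -> x a * x b = 0.
Proof.
move=> /eqP ab; rewrite -rmorphM; have [/eqP E|E] := boolP (qtgt a == qsrc b).
  by apply: brauer_pi_eq0; right; apply/type_threeP; exists a, b.
by rewrite arr_mul_arr // rmorph0.
Qed.

Lemma brauer_idem_idem v w : e v * e w = if v == w then e v else 0.
Proof. by rewrite -rmorphM triv_mul_triv; case: ifP; rewrite ?rmorph0. Qed.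

Lemma brauer_idem_arrow v a : e v * x a = if qsrc a == v then x a else 0.
Proof. by rewrite -rmorphM triv_mul_arr; case: ifP; rewrite ?rmorph0. Qed.

Lemma brauer_arrow_idem v a : x a * e v = if qtgt a == v then x a else 0.
Proof. by rewrite -rmorphM arr_mul_triv; case: ifP; rewrite ?rmorph0. Qed.

(** By the relations of type one the choice of the arrow does not matter; [0] is the default value
    for a vertex without outgoing arrow. *)
Definition brauer_socle (v : qvertex Q) : A :=
  if [pick a : qarrow Q | qsrc a == v] is Some a
  then word (chain_word a (cycle_length a)) else 0.

Lemma brauer_socleE (a : qarrow Q) :
  brauer_socle (qsrc a) = word (chain_word a (cycle_length a)).
Proof.
rewrite /brauer_socle; case: pickP => [b /eqP ba|/(_ a)]; last by rewrite eqxx.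
exact: brauer_word_cycle.
Qed.

(** If the cycle starts with [next c], a relation of type two applies; otherwise [c] and its first
    letter already multiply to zero. [brauer_socle_arrow] is the mirror image. *)
Lemma brauer_arrow_socle c v : x c * brauer_socle v = 0.
Proof.
rewrite /brauer_socle; case: pickP => [a _|_]; last by rewrite mulr0.
have [->|ca] := eqVneq a (next c).
  by rewrite (cycle_length_next 1) brauer_arrow_cycle.
rewrite -(prednK (cycle_length_gt0 a)) /chain_word trajectS brauer_word_cons.
by rewrite mulrA brauer_arrow_arrow // mul0r.
Qed.

Lemma brauer_socle_arrow c v : brauer_socle v * x c = 0.
Proof.
rewrite /brauer_socle; case: pickP => [a _|_]; last by rewrite mul0r.
have [->|ca] := eqVneq c a; first exact: brauer_cycle_arrow.
rewrite -(prednK (cycle_length_gt0 a)) /chain_word trajectSr brauer_word_rcons.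
rewrite -mulrA brauer_arrow_arrow ?mulr0 //; apply: contra ca => /eqP ->.
by rewrite -iterS prednK ?cycle_length_gt0 // iter_next_cycle.
Qed.

Lemma brauer_pi_surj b : exists g, b = brauer_pi g.
Proof. exact: quot_pi_surj. Qed.

(* The coefficient of a good path vanishes on the ideal of relations, hence does
   not depend on the representative. *)
Definition brauer_coef (p : qpath Q) (b : A) : K :=
  if good_word (parrows p) then (sval (cid (brauer_pi_surj b)))@_p else 0.

Lemma brauer_coefE p g : good_word (parrows p) -> brauer_coef p (brauer_pi g) = g@_p.
Proof.
rewrite /brauer_coef => gp; rewrite gp; case: cid => h /= /quot_piP hg.
by apply/eqP; rewrite eq_sym -subr_eq0 -mcoeffB (ideal_coef0 hg).
Qed.

Lemma brauer_coefD p : {morph brauer_coef p : b b' / b + b'}.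
Proof.
move=> b b'; have [gp|/negPf gp] := boolP (good_word (parrows p)); last first.
  by rewrite /brauer_coef gp addr0.
have [[g ->] [g' ->]] := (brauer_pi_surj b, brauer_pi_surj b').
by rewrite -rmorphD !brauer_coefE // mcoeffD.
Qed.

Lemma brauer_coefZ p c b : brauer_coef p (scalar c * b) = c * brauer_coef p b.
Proof.
have [gp|/negPf gp] := boolP (good_word (parrows p)); last first.
  by rewrite /brauer_coef gp mulr0.
have [g ->] := brauer_pi_surj b.
by rewrite -brauer_piZ !brauer_coefE // pa_coeffZ.
Qed.

Lemma brauer_idem_neq0 v : e v != 0.
Proof.
apply/eqP => /(congr1 (brauer_coef (trivial_path v))).
rewrite -(rmorph0 brauer_pi) !brauer_coefE // path_elt_coef eqxx mcoeff0.
by move/eqP; rewrite oner_eq0.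
Qed.

(** The path of index [m] has [m.+1] letters, so it is good exactly below the predecessor of the
    cycle length. *)
Lemma brauer_coef_chain a m b n : (m < (cycle_length a).-1)%N ->
  brauer_coef (chain_path a m) (word (chain_word b n.+1)) =
  ((a == b) && (m == n))%:R.
Proof.
move=> ma; rewrite brauer_coefE; last first.
  rewrite -[good_word _]/(good_word (chain_word a m.+1)) chain_word_good.
  by rewrite -ltn_predRL.
rewrite chain_word_elt path_elt_coef; congr (nat_of_bool _)%:R.
apply/eqP/andP => [/chain_path_inj[-> ->]|[/eqP -> /eqP ->]] //.
Qed.

Lemma brauer_ind_l (X : A -> Prop) :
  (forall b b', X b -> X b' -> X (b + b')) ->
  (forall c b, X b -> X (scalar c * b)) ->
  X 0 -> (forall v, X (e v)) -> (forall a b, X b -> X (x a * b)) ->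
  forall b, X b.
Proof.
move=> XD XZ X0 Xe Xa b; have [g ->] := brauer_pi_surj b.
elim/path_algebra_ind_l: g => // [g h Xg Xh|c g Xg||a g Xg].
- by rewrite rmorphD; exact: XD.
- by rewrite brauer_piZ; exact: XZ.
- by rewrite rmorph0.
by rewrite rmorphM; exact: Xa.
Qed.

Lemma brauer_ind_r (X : A -> Prop) :
  (forall b b', X b -> X b' -> X (b + b')) ->
  (forall c b, X b -> X (scalar c * b)) ->
  X 0 -> (forall v, X (e v)) -> (forall a b, X b -> X (b * x a)) ->
  forall b, X b.
Proof.
move=> XD XZ X0 Xe Xa b; have [g ->] := brauer_pi_surj b.
elim/path_algebra_ind_r: g => // [g h Xg Xh|c g Xg||a g Xg].
- by rewrite rmorphD; exact: XD.
- by rewrite brauer_piZ; exact: XZ.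
- by rewrite rmorph0.
by rewrite rmorphM; exact: Xa.
Qed.

(** A chain prolonged to the left ends with [a], so as a word it starts [n] steps before [a]. *)
Lemma arrow_chain_l a n :
  arrow_chain x prev a n = word (chain_word (iter n prev a) n.+1).
Proof.
elim: n => [|n /= ->]; first by rewrite brauer_word1.
by rewrite -brauer_word_cons /chain_word /= barrow_prevK.
Qed.

(** Left multiplication in [A^c] appends a letter on the right. *)
Lemma arrow_chain_r a n :
  arrow_chain (x : _ -> A^c) next a n = word (chain_word a n.+1).
Proof.
elim: n => [|n IH]; first by rewrite brauer_word1.
have -> : word (chain_word a n.+2) = word (chain_word a n.+1) * x (iter n.+1 next a).
  by rewrite {1}/chain_word trajectSr brauer_word_rcons.
by rewrite -IH.
Qed.

Definition brauer_presentation : chain_presentation K A.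
Proof.
refine (@Build_chain_presentation K A scalar (qvertex Q) (qarrow Q) e x
  (@qsrc Q) (@qtgt Q) prev (fun a => (cycle_length a).-1) brauer_socle
  (fun a n => brauer_coef (chain_path (iter n prev a) n))
  _ _ _ _ _ _ _ _ _ _ _ _).
- exact: alg_mapC.
- exact: brauer_idem_neq0.
- exact: brauer_idem_idem.
- exact: brauer_idem_arrow.
- exact: brauer_arrow_idem.
- move=> c a ca; apply: brauer_arrow_arrow; apply: contra ca => /eqP ->.
  by rewrite barrow_nextK.
- exact: brauer_arrow_socle.
(* The full chain ending with [a] starts with [next a]: one step less than the whole way back around
   the cycle is one step forward. *)
- move=> a; rewrite arrow_chain_l prednK ?cycle_length_gt0 //.
  rewrite -[qtgt a]/(qsrc (next a : qarrow Q)) brauer_socleE.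
  rewrite (cycle_length_next 1); congr (word (chain_word _ _)).
  apply: (can_inj (iter_nextK (cycle_length a).-1)).
  by rewrite iter_prevK -iterSr prednK ?cycle_length_gt0 // iter_next_cycle.
- exact: brauer_ind_l.
- by move=> a n; exact: brauer_coefD.
- by move=> a n c b; exact: brauer_coefZ.
move=> a n b m na; rewrite arrow_chain_l brauer_coef_chain ?cycle_length_prev //.
congr (nat_of_bool _)%:R; case: (n =P m) => [<-|_]; last by rewrite !andbF.
by rewrite (can_eq (iter_prevK n)).
Defined.

Definition opposite_scalar (c : K) : A^c := scalar c.

Lemma opposite_scalar_is_zmod_morphism : zmod_morphism opposite_scalar.
Proof. by move=> c d; rewrite /opposite_scalar rmorphB. Qed.

Lemma opposite_scalar_is_monoid_morphism : monoid_morphism opposite_scalar.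
Proof.
split=> [|c d]; first by rewrite /opposite_scalar rmorph1.
(* Scalars are central, so reversing their product changes nothing. *)
by rewrite /opposite_scalar rmorphM; exact: alg_mapC.
Qed.

HB.instance Definition _ := GRing.isZmodMorphism.Build K A^c opposite_scalar
  opposite_scalar_is_zmod_morphism.
HB.instance Definition _ := GRing.isMonoidMorphism.Build K A^c opposite_scalar
  opposite_scalar_is_monoid_morphism.

(** Sources and targets are exchanged as well, and chains now start with [a], so the functionals
    read off the paths that start there. *)
Definition opposite_brauer_presentation : chain_presentation K A^c.
Proof.
refine (@Build_chain_presentation K A^c opposite_scalar (qvertex Q) (qarrow Q) e x
  (@qtgt Q) (@qsrc Q) next (fun a => (cycle_length a).-1) brauer_socle
  (fun a n => brauer_coef (chain_path a n))
  _ _ _ _ _ _ _ _ _ _ _ _).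
- by move=> c b; exact: esym (alg_mapC c b).
- exact: brauer_idem_neq0.
- move=> v w; rewrite [LHS]brauer_idem_idem eq_sym.
  by case: eqP => // ->.
- by move=> v a; exact: brauer_arrow_idem.
- by move=> v a; exact: brauer_idem_arrow.
- by move=> c a ca; exact: brauer_arrow_arrow.
- by move=> c v; exact: brauer_socle_arrow.
- move=> a; rewrite arrow_chain_r prednK ?cycle_length_gt0 //.
  by rewrite brauer_socleE.
- move=> X XD XZ X0 Xe Xa; apply: brauer_ind_r => // c b Xb.
  by rewrite alg_mapC; exact: XZ.
- by move=> a n; exact: brauer_coefD.
- move=> a n c b; apply: etrans (brauer_coefZ _ c b).
  exact: congr1 (esym (alg_mapC c b)).
by move=> a n b m na; rewrite arrow_chain_r brauer_coef_chain.
Defined.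

End BrauerPresentation.

Theorem corollaryC (K : fieldType) (G : brauer_configuration) :
  multiserial (brauer_algebra K G).
Proof.
split=> [|P|P].
- apply: (@finite_span_finite_dimensional K (alg_space (brauer_algebra K G)) _
    (chain_family (S := brauer_presentation K G))) => b.
  exact: chain_family_span.
- exact: chain_presentation_multiserial_rad (brauer_presentation K G) P.
exact: chain_presentation_multiserial_rad (opposite_brauer_presentation K G) P.
Qed.
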